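(* Let $I\subset\mathbf k[\mathbf x]$ be a monomial ideal with cofinite support and $x_i\notin I$ for all $i$, let $G=\operatorname{Aut}_{\mathbf k}(\mathbf k[\mathbf x]/I)$, let $\mathfrak m$ be the maximal ideal of $\mathbf k[\mathbf x]/I$, let $a\colon G\to\mathrm{GL}(\mathfrak m/\mathfrak m^2)$ be the morphism induced by the action of $G$ on $\mathfrak m/\mathfrak m^2$, and let $U_1=\ker(a)$. For $\alpha\in\mathbb Z^n$ let $s(\alpha)$ denote the sum of its coordinates. Then: (i) $G$ is isomorphic to the semidirect product $U_1\rtimes G_1$, where $G_1$ is the subgroup of $G$ generated by $T$, the toric automorphisms, and the subgroups $U_\alpha$ for roots $\alpha$ with $s(\alpha)=0$. (ii) $U_1$ is a connected unipotent group generated by the subgroups $U_{\alpha,p}$ with $\alpha$ a root with $s(\alpha)>0$ and $p\in N(\alpha)$.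
   Context: Setting: $\mathbf k$ is an algebraically closed field of characteristic zero, $n\ge1$, $M=\mathbb Z^n$ with canonical basis $E=\{e_1,\dots,e_n\}$, and $N_{\mathbf k}=\operatorname{Hom}(M,\mathbf k)\cong\mathbf k^n$ with dual basis $e_1^*,\dots,e_n^*$. $\mathbf k[\mathbf x]=\mathbf k[x_1,\dots,x_n]$ and $\mathbf x^m=x_1^{m_1}\cdots x_n^{m_n}$. For a monomial ideal $I$, $\operatorname{supp}(I)=\{m\in\mathbb Z^n_{\ge0}:\mathbf x^m\in I\}$; $I$ has cofinite support if $\mathbb Z^n_{\ge0}\setminus\operatorname{supp}(I)$ is finite. Set $A=\mathbf k[\mathbf x]/I$. Derivations: for $\alpha\in\mathbb Z^n$ and $p\in N_{\mathbf k}$, $\partial_{\alpha,p}$ denotes the homogeneous derivation $\mathbf x^m\mapsto p(m)\mathbf x^{m+\alpha}$ of $\mathbf k[\mathbf x]$ (whenever it maps $\mathbf k[\mathbf x]$ to itself), and $\overline\partial_{\alpha,p}$ the derivation induced on $A$ when $\partial_{\alpha,p}(I)\subseteq I$. A degree $\alpha$ is inner if $\alpha\in\mathbb Z_{\ge0}^n$ and outer otherwise. Roots: for $\alpha\in\mathbb Z^n$ put $E_\alpha=\{e_i\in E : \alpha+e_i\in\mathbb Z^n_{\ge0}\setminus\operatorname{supp}(I)\}$. A root is a degree $\alpha\ne0$ for which there is a nonzero homogeneous derivation of $A$ of degree $\alpha$; $\mathcal R(I)$ is the set of roots. Explicitly, an inner $\alpha\neq 0$ is a root iff $E_\alpha\neq\varnothing$;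 an outer $\alpha$ is a root iff it has exactly one negative coordinate, say $\alpha_k=-1$, for every $\beta\in\operatorname{supp}(I)$ either $\alpha+\beta\in\operatorname{supp}(I)$ or $\alpha+\beta\notin\mathbb Z^n_{\ge0}$, and $E_\alpha\ne\varnothing$ (then $E_\alpha=\{e_k\}$). For an inner root, $N(\alpha)=\bigoplus_{e_i\in E_\alpha}\mathbf k e_i^*$; for an outer root with $\alpha_k=-1$, $N(\alpha)=\mathbf k e_k^*$. Groups: $G=\operatorname{Aut}_{\mathbf k}(A)$ is a linear algebraic group, and $T\subset G$ is the maximal torus acting by $\overline x_i\mapsto t_i\overline x_i$. For a root $\alpha$ and $p\in N(\alpha)$, $U_{\alpha,p}$ is the closed subgroup generated by $\{\exp(t\,\overline\partial_{\alpha,p}):t\in\mathbf k\}$. When $N(\alpha)$ is one-dimensional (e.g. $\alpha$ outer) it is written $U_\alpha$ (taking $p\neq0$). A toric automorphism of $A$ is an automorphism $\overline x_k\mapsto\overline x_{\sigma(k)}$ induced by a permutation $\sigma\in S_n$ preserving $I$. Every root $\alpha$ with $s(\alpha)=0$ is outer, of the form $e_i-e_j$, $i\ne j$. *)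

(* Defs.v *)
From HB Require Import structures.
From mathcomp Require Import all_boot all_order perm all_algebra.
From mathcomp Require Import boolp classical_sets cardinality.
From mathcomp Require Import mpoly.

Set Implicit Arguments.
Unset Strict Implicit.
Unset Printing Implicit Defensive.

Import Order.TTheory GRing.Theory Num.Theory.

Local Open Scope ring_scope.
Local Open Scope classical_set_scope.
Local Open Scope quotient_scope.

Section AlgebraQuotient.
Variables (k : fieldType) (B : comAlgType k) (I : idealr B).

Definition alg_quot := {ideal_quot I}.
HB.instance Definition _ := GRing.ComNzRing.on alg_quot.
HB.instance Definition _ := EqQuotient.on alg_quot.

Definition alg_quot_scale (c : k) (u : alg_quot) : alg_quot :=
  \pi_alg_quot (c *: 1) * u.

Lemma alg_quot_piD (x y : B) :
  \pi_alg_quot (x + y) = \pi_alg_quot x + \pi_alg_quot y.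
Proof. exact: (Quotient.pi_add I). Qed.
Lemma alg_quot_piM (x y : B) :
  \pi_alg_quot (x * y) = \pi_alg_quot x * \pi_alg_quot y.
Proof. exact: (Quotient.pi_mul I). Qed.
Lemma alg_quot_pi1 : \pi_alg_quot 1 = 1.
Proof. exact: (rmorph1 (\pi_{ideal_quot I})). Qed.

Fact alg_quot_scaleA a b (v : alg_quot) :
  alg_quot_scale a (alg_quot_scale b v) = alg_quot_scale (a * b) v.
Proof.
by rewrite /alg_quot_scale mulrA -alg_quot_piM -scalerAl mul1r scalerA.
Qed.
Fact alg_quot_scale1 : left_id 1 alg_quot_scale.
Proof. by move=> v; rewrite /alg_quot_scale scale1r alg_quot_pi1 mul1r. Qed.
Fact alg_quot_scaleDr : right_distributive alg_quot_scale +%R.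
Proof. by move=> c u v; rewrite /alg_quot_scale mulrDr. Qed.
Fact alg_quot_scaleDl v : {morph alg_quot_scale^~ v : a b / a + b}.
Proof. by move=> a b; rewrite /alg_quot_scale scalerDl alg_quot_piD mulrDl. Qed.
HB.instance Definition _ := GRing.Zmodule_isLmodule.Build k alg_quot
  alg_quot_scaleA alg_quot_scale1 alg_quot_scaleDr alg_quot_scaleDl.

Fact alg_quot_scaleAl (a : k) (u v : alg_quot) : a *: (u * v) = a *: u * v.
Proof. exact: mulrA. Qed.
HB.instance Definition _ :=
  GRing.Lmodule_isLalgebra.Build k alg_quot alg_quot_scaleAl.
Fact alg_quot_scaleAr (a : k) (u v : alg_quot) : a *: (u * v) = u * (a *: v).
Proof. exact: mulrCA. Qed.
HB.instance Definition _ :=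
  GRing.Lalgebra_isAlgebra.Build k alg_quot alg_quot_scaleAr.

Lemma alg_quot_piZ (c : k) (x : B) :
  \pi_alg_quot (c *: x) = c *: \pi_alg_quot x.
Proof. by rewrite -[x in LHS]mul1r scalerAl alg_quot_piM. Qed.

End AlgebraQuotient.

Section SubgroupsOf.
Variable G : groupType.
Local Open Scope group_scope.

Definition is_subgroup (H : set G) : Prop :=
  H 1 /\ (forall x y, H x -> H y -> H (x * y^-1)).

Definition is_normal (H : set G) : Prop :=
  is_subgroup H /\ (forall g x, H x -> H (g * x * g^-1)).

Definition subgroup_generated (S : set G) : set G := smallest is_subgroup S.

End SubgroupsOf.

Section GeneralLinear.
Variables (k : fieldType) (V : lmodType k).

Record GL := MkGL {
  gl_fun :> V -> V;
  gl_linear : linear gl_fun;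
  gl_bij : bijective gl_fun }.

HB.instance Definition _ (g : GL) :=
  GRing.isLinear.Build k V V *:%R (gl_fun g) (gl_linear g).

Lemma gl_ext (f g : GL) : f =1 g -> f = g.
Proof.
case: f g => [f lf bf] [g lg bg] /= /funext e.
by subst g; rewrite (Prop_irrelevance lf lg) (Prop_irrelevance bf bg).
Qed.

HB.instance Definition _ := gen_eqMixin GL.
HB.instance Definition _ := gen_choiceMixin GL.

Fact gl_one_linear : linear (@id V). Proof. by []. Qed.
Definition gl_one : GL := MkGL gl_one_linear (Bijective (frefl _) (frefl _)).

Fact gl_mul_linear (f g : GL) : linear (f \o g).
Proof. by move=> c u v /=; rewrite !linearP. Qed.
Definition gl_mul (f g : GL) : GL :=
  MkGL (gl_mul_linear f g) (bij_comp (gl_bij f) (gl_bij g)).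

Fact gl_inv_ex (f : GL) : exists g : GL, cancel f g /\ cancel g f.
Proof.
have [g fK gK] := gl_bij f.
have lg : linear g.
  by move=> c u v; apply: (can_inj fK); rewrite linearP /= !gK.
by exists (MkGL lg (Bijective gK fK)).
Qed.
Definition gl_inv (f : GL) : GL := sval (cid (gl_inv_ex f)).

Fact gl_mulA : associative gl_mul. Proof. by move=> f g h; exact: gl_ext. Qed.
Fact gl_mul1g : left_id gl_one gl_mul.
Proof. by move=> f; exact: gl_ext. Qed.
Fact gl_mulg1 : right_id gl_one gl_mul.
Proof. by move=> f; exact: gl_ext. Qed.
Fact gl_mulVg : left_inverse gl_one gl_inv gl_mul.
Proof.
move=> f; apply: gl_ext => v /=; rewrite /gl_inv.
by case: (cid _) => g [fK gK] /=; rewrite fK.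
Qed.
Fact gl_mulgV : right_inverse gl_one gl_inv gl_mul.
Proof.
move=> f; apply: gl_ext => v /=; rewrite /gl_inv.
by case: (cid _) => g [fK gK] /=; rewrite gK.
Qed.
HB.instance Definition _ :=
  isGroup.Build GL gl_mulA gl_mul1g gl_mulg1 gl_mulVg gl_mulgV.

End GeneralLinear.

Section AlgebraAutomorphisms.
Variables (k : fieldType) (A : comAlgType k).

Record alg_aut := MkAlgAut {
  aut_fun :> A -> A;
  aut_linear : linear aut_fun;
  aut_one : aut_fun 1 = 1;
  aut_mul : {morph aut_fun : x y / x * y};
  aut_bij : bijective aut_fun }.

HB.instance Definition _ (g : alg_aut) :=
  GRing.isLinear.Build k A A *:%R (aut_fun g) (aut_linear g).
HB.instance Definition _ (g : alg_aut) :=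
  GRing.isMonoidMorphism.Build A A (aut_fun g) (aut_one g, @aut_mul g).

Lemma aut_ext (f g : alg_aut) : f =1 g -> f = g.
Proof.
case: f g => [f f1 f2 f3 f4] [g g1 g2 g3 g4] /= /funext e.
subst g; rewrite (Prop_irrelevance f1 g1) (Prop_irrelevance f2 g2).
by rewrite (Prop_irrelevance f3 g3) (Prop_irrelevance f4 g4).
Qed.

HB.instance Definition _ := gen_eqMixin alg_aut.
HB.instance Definition _ := gen_choiceMixin alg_aut.

Fact aut_one_linear : linear (@id A). Proof. by []. Qed.
Fact aut_one_mul : {morph (@id A) : x y / x * y}. Proof. by []. Qed.
Definition aut_id : alg_aut :=
  MkAlgAut aut_one_linear erefl aut_one_mul (Bijective (frefl _) (frefl _)).

Fact aut_comp_linear (f g : alg_aut) : linear (f \o g).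
Proof. by move=> c u v /=; rewrite !linearP. Qed.
Fact aut_comp_one (f g : alg_aut) : (f \o g) 1 = 1.
Proof. by rewrite /= !aut_one. Qed.
Fact aut_comp_mul (f g : alg_aut) : {morph f \o g : x y / x * y}.
Proof. by move=> u v /=; rewrite !rmorphM. Qed.
Definition aut_comp (f g : alg_aut) : alg_aut :=
  MkAlgAut (aut_comp_linear f g) (aut_comp_one f g) (aut_comp_mul f g)
    (bij_comp (aut_bij f) (aut_bij g)).

Fact aut_inv_ex (f : alg_aut) : exists g : alg_aut, cancel f g /\ cancel g f.
Proof.
have [g fK gK] := aut_bij f.
have lg : linear g.
  by move=> c u v; apply: (can_inj fK); rewrite linearP /= !gK.
have g1 : g 1 = 1 by apply: (can_inj fK); rewrite gK aut_one.
have gM : {morph g : x y / x * y}.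
  by move=> u v; apply: (can_inj fK); rewrite aut_mul !gK.
by exists (MkAlgAut lg g1 gM (Bijective gK fK)).
Qed.
Definition aut_inv (f : alg_aut) : alg_aut := sval (cid (aut_inv_ex f)).

Fact aut_mulA : associative aut_comp.
Proof. by move=> f g h; exact: aut_ext. Qed.
Fact aut_mul1g : left_id aut_id aut_comp.
Proof. by move=> f; exact: aut_ext. Qed.
Fact aut_mulg1 : right_id aut_id aut_comp.
Proof. by move=> f; exact: aut_ext. Qed.
Fact aut_mulVg : left_inverse aut_id aut_inv aut_comp.
Proof.
move=> f; apply: aut_ext => v /=; rewrite /aut_inv.
by case: (cid _) => g [fK gK] /=; rewrite fK.
Qed.
Fact aut_mulgV : right_inverse aut_id aut_inv aut_comp.
Proof.
move=> f; apply: aut_ext => v /=; rewrite /aut_inv.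
by case: (cid _) => g [fK gK] /=; rewrite gK.
Qed.
HB.instance Definition _ :=
  isGroup.Build alg_aut aut_mulA aut_mul1g aut_mulg1 aut_mulVg aut_mulgV.

Lemma aut_mulE (f g : alg_aut) x : (f * g)%g x = f (g x). Proof. by []. Qed.
Lemma aut_mulK (f : alg_aut) : cancel f (f^-1)%g.
Proof. by move=> x; rewrite -aut_mulE mulVg. Qed.
Lemma aut_mulKV (f : alg_aut) : cancel (f^-1)%g f.
Proof. by move=> x; rewrite -aut_mulE mulgV. Qed.

(** [alg_aut A] as a linear algebraic group, for finite-dimensional [A]: a
    closed subgroup of GL(A).  The coordinate ring of GL(A) is generated by the
    matrix coefficients of [g] together with 1/det, or equivalently by the
    matrix coefficients of [g] and of its inverse. *)
Inductive regular_function : (alg_aut -> k) -> Prop :=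
| regular_coef (l : {scalar A}) (v : A) : regular_function (fun g => l (g v))
| regular_coefV (l : {scalar A}) (v : A) :
    regular_function (fun g => l ((g^-1)%g v))
| regular_const (c : k) : regular_function (fun=> c)
| regular_add f h : regular_function f -> regular_function h ->
    regular_function (fun g => f g + h g)
| regular_mul f h : regular_function f -> regular_function h ->
    regular_function (fun g => f g * h g).

Definition regular_map (phi : alg_aut -> alg_aut) : Prop :=
  forall f, regular_function f -> regular_function (f \o phi).

Definition zariski_closed (Z : set alg_aut) : Prop :=
  exists2 F : set (alg_aut -> k), F `<=` regular_function &
    Z = [set g | forall f, F f -> f g = 0].

Definition closed_subgroup (H : set alg_aut) : Prop :=
  is_subgroup H /\ zariski_closed H.

Definition closed_subgroup_generated (S : set alg_aut) : set alg_aut :=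
  smallest closed_subgroup S.

Definition zariski_connected (H : set alg_aut) : Prop :=
  forall Z1 Z2, zariski_closed Z1 -> zariski_closed Z2 ->
    H `<=` Z1 `|` Z2 -> H `&` Z1 `&` Z2 = set0 -> H `<=` Z1 \/ H `<=` Z2.

Definition unipotent_subset (H : set alg_aut) : Prop :=
  forall g, H g -> exists N : nat, forall x, iter N (fun y => g y - y) x = 0.

(** The whole group is the semidirect product of its closed subgroups [U]
    (normal) and [H], as an algebraic group: [(u, h) |-> u * h] is a bijection
    from [U x H] whose inverse [g |-> (u g, h g)] is a morphism. *)
Definition is_semidirect_product (U H : set alg_aut) : Prop :=
  [/\ closed_subgroup U, closed_subgroup H, is_normal U,
      U `&` H = [set 1%g] &
      exists u h : alg_aut -> alg_aut, [/\ regular_map u, regular_map h &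
        forall g, [/\ U (u g), H (h g) & g = (u g * h g)%g]]].

(** The exponential is only defined for nilpotent [d], as a finite sum. *)
Definition is_exp (d : A -> A) (g : alg_aut) : Prop :=
  exists2 N : nat, (forall x, iter N d x = 0) &
    forall x, g x = \sum_(i < N) (i`!%:R)^-1 *: iter i d x.

Definition is_derivation (D : A -> A) : Prop :=
  linear D /\ (forall x y, D (x * y) = D x * y + x * D y).

Definition maximal_ideal (m : idealr A) : Prop :=
  forall J : idealr A, {subset m <= J} -> {subset J <= m}.

Definition the_maximal_ideal (m : idealr A) : Prop :=
  maximal_ideal m /\ (forall m' : idealr A, maximal_ideal m' -> m' =i m).

Section Cotangent.
Variable m : idealr A.

Fact idealr_scale_closed : GRing.scaler_closed m.
Proof. by move=> c x xm; rewrite -[x]mul1r scalerAl idealMr. Qed.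

Definition ideal_space := {x : A | x \in m}.
HB.instance Definition _ := SubType.on ideal_space.
HB.instance Definition _ := Choice.on ideal_space.
Fact ideal_space_submod : GRing.submod_closed m.
Proof.
by split=> [|c x y xm ym]; rewrite ?idealr0 // rpredD // idealr_scale_closed.
Qed.
HB.instance Definition _ :=
  GRing.SubChoice_isSubLmodule.Build k A (mem m) ideal_space ideal_space_submod.

Definition ideal_square : {pred ideal_space} := fun x =>
  `[< exists s : seq (ideal_space * ideal_space),
        val x = \sum_(y <- s) val y.1 * val y.2 >].

Fact ideal_square_scale (c : k) (x : ideal_space) :
  x \in ideal_square -> c *: x \in ideal_square.
Proof.
move=> /asboolP[s xE]; apply/asboolP.
exists [seq (c *: y.1, y.2) | y <- s].
rewrite big_map linearZ /= xE scaler_sumr; apply: eq_bigr => y _.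
by rewrite /= scalerAl.
Qed.
Fact ideal_square_zmod : zmod_closed ideal_square.
Proof.
split=> [|x y /asboolP[s xE] /(ideal_square_scale (-1)) /asboolP[t yE]].
  by apply/asboolP; exists [::]; rewrite big_nil linear0.
apply/asboolP; exists (s ++ t).
by rewrite big_cat /= -xE -yE -linearD scaleN1r.
Qed.
HB.instance Definition _ :=
  GRing.isZmodClosed.Build ideal_space ideal_square ideal_square_zmod.

(** The quotient [m / m^2]. *)
Definition cotangent := Quotient.quot ideal_square.
HB.instance Definition _ := GRing.Zmodule.on cotangent.
HB.instance Definition _ := EqQuotient.on cotangent.

Lemma cotangent_eq (x y : ideal_space) :
  (\pi_cotangent x = \pi_cotangent y) <-> (x - y \in ideal_square).
Proof.
by split=> [/eqP|h]; [|apply/eqP];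
  rewrite -(Quotient.idealrBE ideal_square x y).
Qed.
Lemma cotangent_piD (x y : ideal_space) :
  \pi_cotangent (x + y) = \pi_cotangent x + \pi_cotangent y.
Proof. exact: (Quotient.pi_add ideal_square). Qed.

Definition cotangent_scale (c : k) (u : cotangent) : cotangent :=
  \pi_cotangent (c *: repr u).

Lemma cotangent_scaleE c x :
  cotangent_scale c (\pi_cotangent x) = \pi_cotangent (c *: x).
Proof.
apply/cotangent_eq; rewrite -scalerBr ideal_square_scale //.
by apply/cotangent_eq; rewrite reprK.
Qed.
Fact cotangent_scaleA a b (v : cotangent) :
  cotangent_scale a (cotangent_scale b v) = cotangent_scale (a * b) v.
Proof.
elim/quotW: v => x.
by rewrite (cotangent_scaleE b) (cotangent_scaleE a) cotangent_scaleE scalerA.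
Qed.
Fact cotangent_scale1 : left_id 1 cotangent_scale.
Proof. by move=> v; rewrite -[v]reprK !cotangent_scaleE scale1r. Qed.
Fact cotangent_scaleDr : right_distributive cotangent_scale +%R.
Proof.
move=> c u v; rewrite -[u]reprK -[v]reprK -cotangent_piD !cotangent_scaleE.
by rewrite scalerDr cotangent_piD.
Qed.
Fact cotangent_scaleDl v : {morph cotangent_scale^~ v : a b / a + b}.
Proof.
move=> a b; rewrite -[v]reprK !cotangent_scaleE -cotangent_piD.
by rewrite scalerDl.
Qed.
HB.instance Definition _ := GRing.Zmodule_isLmodule.Build k cotangent
  cotangent_scaleA cotangent_scale1 cotangent_scaleDr cotangent_scaleDl.

Hypothesis m_max : the_maximal_ideal m.

(** Uniqueness of [m] makes it stable under automorphisms, so that they act on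
    [m / m^2]. *)
Lemma aut_maximal_ideal (g : alg_aut) x : x \in m -> g x \in m.
Proof.
have pull (J : idealr A) (h : alg_aut) : exists J' : idealr A,
    forall y, (y \in J') = (h y \in J).
  have Jid : idealr_closed (fun y => h y \in J).
    split=> [||a u v uJ vJ]; rewrite -topredE /=.
    - by rewrite linear0 idealr0.
    - by rewrite aut_one idealr1.
    by rewrite linearD /= aut_mul rpredD ?idealMr.
  pose J1 := isIdealr.Build A (fun y => h y \in J) Jid.
  by exists (HB.pack_for (idealr A) (fun y => h y \in J) J1).
have [m' m'E] := pull m g.
suff /(m_max.2) e : maximal_ideal m' by move=> xm; rewrite -m'E e.
move=> J m'J y yJ; rewrite m'E.
have [J' J'E] := pull J (g^-1)%g.
apply: (m_max.1 J'); last by rewrite J'E aut_mulK.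
by move=> z zm; rewrite J'E; apply: m'J; rewrite m'E aut_mulKV.
Qed.

Definition ideal_space_map (g : alg_aut) (x : ideal_space) : ideal_space :=
  Sub (g (val x)) (aut_maximal_ideal g (valP x)).

Definition cotangent_map (g : alg_aut) (u : cotangent) : cotangent :=
  \pi_cotangent (ideal_space_map g (repr u)).

Fact ideal_space_map_linear g : linear (ideal_space_map g).
Proof.
move=> c x y; apply: val_inj; by rewrite [LHS]SubK !linearP.
Qed.
HB.instance Definition _ g := GRing.isLinear.Build k ideal_space ideal_space
  *:%R (ideal_space_map g) (ideal_space_map_linear g).

Lemma cotangent_mapE g (x : ideal_space) :
  cotangent_map g (\pi_cotangent x) = \pi_cotangent (ideal_space_map g x).
Proof.
apply/cotangent_eq; rewrite -linearB.
have /cotangent_eq/asboolP[s sE] : \pi_cotangent (repr (\pi_cotangent x)) = \pi_cotangent x.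
  exact: reprK.
apply/asboolP; exists [seq (ideal_space_map g y.1, ideal_space_map g y.2) | y <- s].
rewrite big_map [LHS]SubK sE linear_sum /=.
by apply: eq_bigr => y _; rewrite aut_mul.
Qed.

Fact cotangent_map_linear g : linear (cotangent_map g).
Proof.
move=> c u v; rewrite -[u]reprK -[v]reprK.
rewrite -[c *: _]/(cotangent_scale c _) cotangent_scaleE -cotangent_piD.
rewrite !cotangent_mapE linearP cotangent_piD.
by rewrite -[c *: _ in RHS]/(cotangent_scale c _) cotangent_scaleE.
Qed.

Lemma cotangent_map_comp g h u :
  cotangent_map (g * h)%g u = cotangent_map g (cotangent_map h u).
Proof.
elim/quotW: u => x; rewrite (cotangent_mapE h) (cotangent_mapE g).
rewrite cotangent_mapE; congr (\pi_cotangent _); exact: val_inj.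
Qed.
Lemma cotangent_map1 u : cotangent_map 1%g u = u.
Proof.
elim/quotW: u => x; rewrite cotangent_mapE; congr (\pi_cotangent _).
exact: val_inj.
Qed.
Fact cotangent_map_bij g : bijective (cotangent_map g).
Proof.
by exists (cotangent_map g^-1%g) => u;
  rewrite -cotangent_map_comp ?mulVg ?mulgV cotangent_map1.
Qed.

Definition cotangent_rep (g : alg_aut) : GL cotangent :=
  MkGL (cotangent_map_linear g) (cotangent_map_bij g).

Fact cotangent_repM : {morph cotangent_rep : g h / (g * h)%g}.
Proof. by move=> g h; apply: gl_ext => u; exact: cotangent_map_comp. Qed.
HB.instance Definition _ :=
  isMultiplicative.Build alg_aut (GL cotangent) cotangent_rep cotangent_repM.

End Cotangent.

Definition cotangent_kernel (m : idealr A) (m_max : the_maximal_ideal m) :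
  set alg_aut := [set g | cotangent_rep m_max g = 1%g].

End AlgebraAutomorphisms.

Section MonomialAlgebra.
Variables (k : fieldType) (n : nat) (I : idealr {mpoly k[n]}).

Definition monomial_ideal : Prop :=
  forall f, f \in I -> exists s : seq ({mpoly k[n]} * 'X_{1..n}),
    (forall y, y \in s -> 'X_[y.2] \in I) /\ f = \sum_(y <- s) y.1 * 'X_[y.2].

Definition supp : set 'X_{1..n} := [set m | 'X_[m] \in I].

Definition cofinite_support : Prop := finite_set (~` supp).

Definition monomial_algebra := alg_quot I.
Local Notation A := monomial_algebra.

Definition residue (f : {mpoly k[n]}) : A := \pi_(alg_quot I) f.

(** The lattice [M = Z^n] is ['rV[int]_n], with canonical basis
    [delta_mx 0 i]. *)
Definition mnm_vec (m : 'X_{1..n}) : 'rV[int]_n := \row_i (m i)%:Z.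

Definition nonneg (b : 'rV[int]_n) : bool := [forall i, 0 <= b 0 i].

(** The multi-index of a vector of [Z_{>=0}^n]; meaningless otherwise. *)
Definition vec_mnm (b : 'rV[int]_n) : 'X_{1..n} :=
  [multinom absz (b 0%R i) | i < n].

(** The Laurent monomial [x^b], replaced by 0 when it is not in [k[x]]. *)
Definition xpow (b : 'rV[int]_n) : {mpoly k[n]} :=
  if nonneg b then 'X_[vec_mnm b] else 0.

Definition coord_sum (a : 'rV[int]_n) : int := \sum_i a 0 i.

(** [N_k = Hom(M, k)], in coordinates with respect to the dual basis. *)
Definition pairing (p : 'rV[k]_n) (m : 'rV[int]_n) : k :=
  \sum_i p 0 i * (m 0 i)%:~R.

(** [x^m |-> p(m) x^(m + a)].  When this map preserves [k[x]], the terms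
    dropped by [xpow] all have coefficient [p(m) = 0]. *)
Definition hom_deriv (a : 'rV[int]_n) (p : 'rV[k]_n) (f : {mpoly k[n]}) :
    {mpoly k[n]} :=
  \sum_(m <- msupp f)
    (f@_m * pairing p (mnm_vec m)) *: xpow (mnm_vec m + a).

(** The map induced on [A]; it does not depend on the representative as soon
    as [hom_deriv a p] maps [I] into [I]. *)
Definition hom_deriv_quot (a : 'rV[int]_n) (p : 'rV[k]_n) (u : A) : A :=
  residue (hom_deriv a p (repr u)).

Definition homogeneous_of_degree (a : 'rV[int]_n) (D : A -> A) : Prop :=
  forall m : 'X_{1..n}, exists c : k,
    D (residue 'X_[m]) = c *: residue (xpow (mnm_vec m + a)).

Definition is_root (a : 'rV[int]_n) : Prop :=
  a <> 0 /\ exists D : A -> A,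
    [/\ is_derivation D, homogeneous_of_degree a D & exists u, D u <> 0].

Definition E_set (a : 'rV[int]_n) (i : 'I_n) : Prop :=
  nonneg (a + delta_mx 0 i) /\ ~ supp (vec_mnm (a + delta_mx 0 i)).

Definition N_space (a : 'rV[int]_n) (p : 'rV[k]_n) : Prop :=
  if nonneg a then forall i, p 0 i <> 0 -> E_set a i
  else exists (j : 'I_n) (c : k), a 0 j = -1 /\ p = c *: delta_mx 0 j.

Definition root_subgroup (a : 'rV[int]_n) (p : 'rV[k]_n) : set (alg_aut A) :=
  closed_subgroup_generated
    [set g | exists t : k, is_exp (fun u => t *: hom_deriv_quot a p u) g].

Definition torus : set (alg_aut A) :=
  [set g | exists t : 'I_n -> k, (forall i, t i <> 0) /\
     (forall i, g (residue 'X_i) = t i *: residue 'X_i)].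

Definition toric_automorphisms : set (alg_aut A) :=
  [set g | exists s : 'S_n,
     (forall f, (f \mPo [tuple 'X_(s i) | i < n] \in I) = (f \in I)) /\
     (forall i, g (residue 'X_i) = residue 'X_(s i))].

(** Roots with [s(a) = 0] are of the form [e_i - e_j], so [N(a)] is a line and
    all choices of [p != 0] in it give the same subgroup [U_a]. *)
Definition G1 : set (alg_aut A) :=
  subgroup_generated (torus `|` toric_automorphisms `|`
    [set g | exists a p, [/\ is_root a, coord_sum a = 0, N_space a p, p <> 0 &
       root_subgroup a p g]]).

Definition positive_root_subgroups : set (alg_aut A) :=
  [set g | exists a p, [/\ is_root a, 0 < coord_sum a, N_space a p &
     root_subgroup a p g]].

End MonomialAlgebra.

Arguments hom_deriv_quot {k n} I.
Arguments homogeneous_of_degree {k n} I.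
Arguments is_root {k n} I.
Arguments E_set {k n} I.
Arguments N_space {k n} I.
Arguments root_subgroup {k n} I.
Arguments torus {k n} I.
Arguments toric_automorphisms {k n} I.
Arguments G1 {k n} I.
Arguments positive_root_subgroups {k n} I.

(* Main.v *)
Require Import Defs.
From HB Require Import structures.
From mathcomp Require Import all_boot all_order perm all_algebra zify.
From mathcomp Require Import boolp classical_sets cardinality.
From mathcomp Require Import mpoly.

(** The algebra [A = k[x] / I] has the monomials outside of [I] as a finite
    basis, is graded by total degree and by multidegree, and is local with
    maximal ideal [m] spanned by the monomials of positive degree.  As no
    variable lies in [I], the filtration of [A] by order is the filtration by
    the powers of [m], so every automorphism respects it.

    Since [I] is homogeneous, the graded ring of this filtration is again [A].
    An automorphism [g] therefore induces an automorphism [linear_part g] of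
    [A], the substitution of the linear parts of the [g x_i]; its matrix
    coefficients are some of those of [g], and [g |-> linear_part g] is an
    idempotent morphism of algebraic groups.  Its kernel is the kernel [U_1] of
    the action on [m / m^2] ([cotangent_kernelE]); it is unipotent, because
    [g - 1] raises orders for [g] in [U_1].  The image is the closed subgroup of
    graded automorphisms, whence the semidirect product
    ([raises1_graded_semidirect]).  What remains is to find generators of the
    kernel and of the image.

    Kernel.  If [g - 1] raises orders by [d > 0], its leading part is a
    derivation of degree [d].  Its multihomogeneous components are derivations
    of [A], hence root derivations, and their exponentials lie in root
    subgroups.  Dividing [g] by the product of these exponentials raises [d],
    and a nilpotency argument ends the induction ([raises1_generated]).
    Conjugation by homotheties joins each element of [U_1] to 1 by an affine
    line, so [U_1] is connected.

    Image.  Let a graded automorphism [g] have matrix [M], with inverse [N].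
    Conjugating the Euler derivation [x_i d/dx_i] by [g] gives a derivation of
    [A] whose multihomogeneous components show that [e_q - e_l] is a root, or
    zero, as soon as [M_li] and [N_iq] are nonzero.  Commutators make the
    relation [e_q - e_l is a root or zero] a preorder.  As [det M] is nonzero,
    some permutation [s] satisfies [M_(l, s l) != 0] for all [l]; then the rows
    of [N] permuted by [s] form an invertible matrix of the incidence algebra
    of this preorder.  Gaussian elimination inside that algebra
    ([incidence_unit_generated]) writes it as a product of diagonal matrices
    and root transvections, and [g] differs from this product by the
    permutation of variables [s] ([graded_auts_sub_G1]). *)

Set Implicit Arguments.
Unset Strict Implicit.
Unset Printing Implicit Defensive.

Import Order.TTheory GRing.Theory Num.Theory.

Local Open Scope ring_scope.
Local Open Scope classical_set_scope.

(** * Elimination in the incidence algebra of a preorder *)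

Section IncidenceElimination.
Variables (F : fieldType) (n : nat) (R : rel 'I_n).
Hypotheses (R_refl : reflexive R) (R_trans : transitive R).

Definition incidence (Q : 'M[F]_n) : Prop := forall i j, Q i j != 0 -> R i j.

Lemma incidence1 : incidence 1%:M.
Proof. by move=> i j; rewrite mxE; case: (i =P j) => [->|_]; rewrite ?eqxx. Qed.

Lemma incidenceD Q Q' : incidence Q -> incidence Q' -> incidence (Q + Q').
Proof.
move=> h h' i j; rewrite mxE => nz.
have [q0|/h//] := eqVneq (Q i j) 0; apply: h'.
by move: nz; rewrite q0 add0r.
Qed.

Lemma incidenceZ c Q : incidence Q -> incidence (c *: Q).
Proof. by move=> h i j; rewrite mxE mulf_eq0 negb_or => /andP[_ /h]. Qed.

Lemma incidence_delta i j : R i j -> incidence (delta_mx i j).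
Proof.
by move=> Rij a b; rewrite mxE; case: andP => [[/eqP-> /eqP->]//|]; rewrite eqxx.
Qed.

Lemma incidenceM Q Q' : incidence Q -> incidence Q' -> incidence (Q *m Q').
Proof.
move=> h h' i j; rewrite mxE => nz.
case: (pickP (fun l => Q i l * Q' l j != 0)) => [l|all0].
  by rewrite mulf_eq0 negb_or => /andP[/h + /h']; apply: R_trans.
by rewrite big1 ?eqxx // in nz => l _; apply/eqP/negbFE/all0.
Qed.

Lemma unitmx_det_term (Q : 'M[F]_n) : Q \in unitmx ->
  exists s : 'S_n, forall i, Q i (s i) != 0.
Proof.
rewrite unitmxE unitfE => nz.
have [s /forallP ps|no] := pickP (fun s : 'S_n => [forall i, Q i (s i) != 0]).
  by exists s.
case/eqP: nz; rewrite /determinant big1 // => s _.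
have /negbT := no s; rewrite negb_forall => /existsP[i /negPn/eqP q0].
by rewrite (bigD1 i) //= q0 mul0r mulr0.
Qed.

(** A permutation whose orbits climb along a preorder goes back down again. *)
Lemma perm_preorder_sym (s : 'S_n) (i : 'I_n) :
  (forall i, R i (s i)) -> R (s i) i.
Proof.
move=> Rs.
have iterR m j : R j (iter m s j).
  by elim: m j => [|m IH] j //; rewrite iterSr; apply: R_trans (IH _).
have := iterR (order s i).-1 (s i).
by rewrite -iterSr prednK ?order_gt0 // iter_order //; apply: perm_inj.
Qed.

Variable S : 'M[F]_n -> Prop.
Hypothesis S_mul : forall Q Q', S Q -> S Q' -> S (Q *m Q').
Hypothesis S_diag : forall d : 'rV[F]_n, (forall i, d 0 i != 0) -> S (diag_mx d).
Hypothesis S_elem : forall i j c, R i j -> i != j -> S (1%:M + c *: delta_mx i j).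

Let S1 : S 1%:M.
Proof.
have <- : diag_mx (const_mx 1) = 1%:M :> 'M[F]_n by exact: diag_const_mx.
by apply: S_diag => i; rewrite mxE oner_eq0.
Qed.

Lemma transvection_col (i : 'I_n) (v : 'I_n -> F) (s : seq 'I_n) :
  v i = 0 -> (forall j, v j != 0 -> R j i) ->
  S (1%:M + \sum_(j <- s) v j *: delta_mx j i).
Proof.
move=> vi0 vR; elim: s => [|a s IH]; first by rewrite big_nil addr0.
have [va0|va] := eqVneq (v a) 0.
  by rewrite big_cons va0 scale0r add0r.
have ai : a != i by apply: contraNneq va => ->; rewrite vi0.
have -> : 1%:M + \sum_(j <- a :: s) v j *: delta_mx j i =
   (1%:M + v a *: delta_mx a i) *m (1%:M + \sum_(j <- s) v j *: delta_mx j i).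
  rewrite big_cons mulmxDl mul1mx mulmxDr mulmx1 mulmx_sumr.
  rewrite [X in _ + (_ + X)]big1 => [|j _].
    by rewrite addr0 -addrA; congr (_ + _); exact: addrC.
  have [->|vj] := eqVneq (v j) 0; first by rewrite scale0r mulmx0.
  rewrite -scalemxAl -scalemxAr mul_delta_mx_0 ?scaler0 //.
  by apply: contraNneq vj => <-; rewrite vi0.
by apply: S_mul => //; apply: S_elem => //; apply: vR.
Qed.

Lemma transvection_row (i : 'I_n) (v : 'I_n -> F) (s : seq 'I_n) :
  v i = 0 -> (forall j, v j != 0 -> R i j) ->
  S (1%:M + \sum_(j <- s) v j *: delta_mx i j).
Proof.
move=> vi0 vR; elim: s => [|a s IH]; first by rewrite big_nil addr0.
have [va0|va] := eqVneq (v a) 0.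
  by rewrite big_cons va0 scale0r add0r.
have ai : i != a by apply: contraNneq va => <-; rewrite vi0.
have -> : 1%:M + \sum_(j <- a :: s) v j *: delta_mx i j =
   (1%:M + v a *: delta_mx i a) *m (1%:M + \sum_(j <- s) v j *: delta_mx i j).
  rewrite big_cons mulmxDl mul1mx mulmxDr mulmx1 mulmx_sumr.
  rewrite [X in _ + (_ + X)]big1 => [|j _].
    by rewrite addr0 -addrA; congr (_ + _); exact: addrC.
  by rewrite -scalemxAl -scalemxAr mul_delta_mx_0 ?scaler0 // eq_sym.
by apply: S_mul => //; apply: S_elem => //; apply: vR.
Qed.

Definition cleared (Q : 'M[F]_n) : {set 'I_n} :=
  [set i | [forall j, (j != i) ==> (Q i j == 0) && (Q j i == 0)]].

Lemma clearedP (Q : 'M[F]_n) i :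
  reflect (forall j, j != i -> Q i j = 0 /\ Q j i = 0) (i \in cleared Q).
Proof.
rewrite inE; apply: (iffP forallP) => h j; last first.
  by apply/implyP => /h[-> ->]; rewrite eqxx.
by move=> ji; have /implyP/(_ ji)/andP[/eqP-> /eqP->] := h j.
Qed.

Lemma sum_delta_col (i : 'I_n) (v : 'I_n -> F) a b :
  (\sum_j v j *: delta_mx j i : 'M_n) a b = v a * (b == i)%:R.
Proof.
rewrite summxE (bigD1 a) //= big1 ?addr0 => [|j ja]; rewrite !mxE.
  by rewrite eqxx.
by rewrite eq_sym (negbTE ja) mulr0.
Qed.

Lemma sum_delta_row (i : 'I_n) (v : 'I_n -> F) a b :
  (\sum_j v j *: delta_mx i j : 'M_n) a b = (a == i)%:R * v b.
Proof.
rewrite summxE (bigD1 b) //= big1 ?addr0 => [|j jb]; rewrite !mxE.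
  by rewrite eqxx andbT mulrC.
by rewrite [b == j]eq_sym (negbTE jb) andbF mulr0.
Qed.

Lemma mul_transvection_col (i : 'I_n) (v : 'I_n -> F) (X : 'M[F]_n) a b :
  ((1%:M + \sum_j v j *: delta_mx j i) *m X) a b = X a b + v a * X i b.
Proof.
rewrite mulmxDl mul1mx mxE; congr (_ + _); rewrite mxE (bigD1 i) //=.
rewrite sum_delta_col eqxx mulr1 big1 ?addr0 // => j ji.
by rewrite sum_delta_col (negbTE ji) mulr0 mul0r.
Qed.

Lemma mul_transvection_row (i : 'I_n) (v : 'I_n -> F) (X : 'M[F]_n) a b :
  (X *m (1%:M + \sum_j v j *: delta_mx i j)) a b = X a b + X a i * v b.
Proof.
rewrite mulmxDr mulmx1 mxE; congr (_ + _); rewrite mxE (bigD1 i) //=.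
rewrite sum_delta_row eqxx mul1r big1 ?addr0 // => j ji.
by rewrite sum_delta_row (negbTE ji) mul0r mulr0.
Qed.

(** Two row or column operations along [R] clear the row and the column of a
    nonzero diagonal entry; indices that were already cleared have zero
    multipliers, so they are not disturbed. *)
Lemma clear_pivot (Q : 'M[F]_n) i : incidence Q -> Q \in unitmx -> Q i i != 0 ->
  exists Q' : 'M[F]_n, [/\ incidence Q', Q' \in unitmx,
    i |: cleared Q \subset cleared Q' & S Q' -> S Q].
Proof.
move=> Qinc Qu nz.
pose a := Q i i.
pose Q' : 'M[F]_n := \matrix_(j, l)
  if (j == i) || (l == i) then ((j == i) && (l == i))%:R * a
  else Q j l - Q j i * Q i l / a.
pose v j := if j == i then 0 else Q j i / a.
pose w j := if j == i then 0 else Q i j / a.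
have vi0 : v i = 0 by rewrite /v eqxx.
have wi0 : w i = 0 by rewrite /w eqxx.
have QE : Q = (1%:M + \sum_j v j *: delta_mx j i) *m Q' *m
              (1%:M + \sum_j w j *: delta_mx i j).
  apply/matrixP => j l.
  rewrite mul_transvection_row !mul_transvection_col /v /w !mxE eqxx /=.
  have [->|ji] := eqVneq j i; have [->|li] := eqVneq l i => //=.
  - by rewrite !mul1r !mulr0 mul0r !addr0.
  - by rewrite !mul0r !addr0 add0r mul1r mulrC divfK.
  - by rewrite !mul0r !mulr0 add0r addr0 mul1r divfK.
  rewrite !mul0r !mulr0 add0r addr0 mul1r divfK // mulrA addrAC.
  by rewrite -addrA subrr addr0.
exists Q'; split.
- move=> j l; rewrite mxE.
  have [->|ji] := eqVneq j i; have [->|li] := eqVneq l i => //=.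
  + by rewrite mul0r eqxx.
  + by rewrite mul0r eqxx.
  have [q0|/Qinc//] := eqVneq (Q j l) 0.
  rewrite q0 sub0r oppr_eq0 !mulf_eq0 !negb_or -andbA.
  by case/and3P=> /Qinc Rji /Qinc Ril _; apply: R_trans Rji Ril.
- by move: Qu; rewrite QE !unitmx_mul => /andP[/andP[_ ->]].
- apply/fintype.subsetP => c; rewrite in_setU1.
  have [-> _|ci /=] := eqVneq c i.
    by apply/clearedP => j ji; rewrite !mxE eqxx (negbTE ji) /= mul0r.
  move/clearedP => cQ; apply/clearedP => j jc.
  have [Qci Qic] : Q c i = 0 /\ Q i c = 0 by apply: cQ; rewrite eq_sym.
  have [Qcj Qjc] := cQ j jc.
  rewrite !mxE (negbTE ci) /= Qci Qic Qcj Qjc !mul0r !mulr0 !mul0r.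
  by rewrite subr0; case: ifP; rewrite mul0r.
move=> SQ'; rewrite QE; apply: S_mul.
  apply: S_mul => //; apply: transvection_col => // j; rewrite /v.
  by case: ifP => [_|_]; rewrite ?eqxx // mulf_eq0 negb_or => /andP[/Qinc].
apply: transvection_row => // j; rewrite /w.
by case: ifP => [_|_]; rewrite ?eqxx // mulf_eq0 negb_or => /andP[/Qinc].
Qed.

(** A vanishing diagonal entry is repaired by adding to its column the one
    through which a nonzero term of the determinant passes: both indices are
    then equivalent for the preorder [R]. *)
Lemma make_pivot (Q : 'M[F]_n) i : incidence Q -> Q \in unitmx ->
  exists Q' : 'M[F]_n, [/\ incidence Q', Q' \in unitmx,
    cleared Q \subset cleared Q', Q' i i != 0 & S Q' -> S Q].
Proof.
move=> Qinc Qu; have [nz|] := eqVneq (Q i i) 0; last by exists Q.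
have [s Qs] := unitmx_det_term Qu.
have Rs j : R j (s j) by apply: Qinc.
have Rsi := perm_preorder_sym i Rs.
have si : s i != i by apply: contraNneq (Qs i) => ->; rewrite nz.
pose P c : 'M[F]_n := 1%:M + c *: delta_mx (s i) i.
have PE c a b (X : 'M[F]_n) : (X *m P c) a b = X a b + c * X a (s i) * (b == i)%:R.
  rewrite mulmxDr mulmx1 mxE; congr (_ + _).
  rewrite -scalemxAr mxE -mulrA; congr (_ * _).
  rewrite mxE (bigD1 (s i)) //= big1 => [|j ji].
    by rewrite addr0 mxE eqxx.
  by rewrite mxE (negbTE ji) mulr0.
have QE : Q = Q *m P 1 *m P (- 1).
  apply/matrixP => a b; rewrite !PE !mul1r [s i == i](negbTE si) mulr0 addr0.
  by rewrite mulN1r mulNr addrK.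
exists (Q *m P 1); split.
- apply: incidenceM => //; apply: incidenceD; first exact: incidence1.
  by apply/incidenceZ/incidence_delta.
- by move: Qu; rewrite {1}QE unitmx_mul => /andP[].
- apply/fintype.subsetP => c /clearedP cQ; apply/clearedP => j jc.
  have ci : c != i.
    by apply: contraNneq (Qs i) => ci; rewrite -{1}ci (cQ (s i) _).1 // ci.
  have csi : c != s i.
    by apply: contraNneq (Qs i) => csi; rewrite -csi (cQ i _).2 // eq_sym.
  have Qcsi : Q c (s i) = 0 by rewrite (cQ (s i) _).1 // eq_sym.
  rewrite !PE (negbTE ci) Qcsi !mulr0 mul0r !addr0; exact: cQ.
- by rewrite PE nz eqxx add0r mul1r mulr1; apply: Qs.
by move=> SQ'; rewrite QE; apply: S_mul => //; apply: S_elem.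
Qed.

(** Each round clears one more index without leaving the incidence algebra, so
    the elimination ends with an invertible diagonal matrix. *)
Theorem incidence_unit_generated (Q : 'M[F]_n) :
  incidence Q -> Q \in unitmx -> S Q.
Proof.
have [d] := ubnP #|~: cleared Q|; elim: d => // d IH in Q *.
move=> led Qinc Qu.
have [/eqP all_cleared|] := boolP (cleared Q == finset.setT); last first.
  rewrite -finset.subTset => /fintype.subsetPn[i _ iQ].
  have [Q1 [inc1 u1 sub1 nz1 SQ1]] := make_pivot i Qinc Qu.
  have [Q2 [inc2 u2 sub2 SQ2]] := clear_pivot inc1 u1 nz1.
  apply/SQ1/SQ2/IH => //; rewrite -ltnS; apply: leq_trans led.
  rewrite ltnS; apply: proper_card; rewrite finset.properC.
  have sub : cleared Q \subset cleared Q2.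
    by apply: fintype.subset_trans sub1 (fintype.subset_trans _ sub2); apply: finset.subsetUr.
  rewrite properE sub /=; apply/fintype.subsetPn; exists i => //.
  by apply: (fintype.subsetP sub2); rewrite in_setU1 eqxx.
have Qdiag i j : j != i -> Q i j = 0.
  have : i \in cleared Q by rewrite all_cleared inE.
  by move/clearedP => /(_ j) + ji; case/(_ ji).
have [s Qs] := unitmx_det_term Qu.
have -> : Q = diag_mx (\row_i Q i i).
  apply/matrixP => i j; rewrite !mxE; have [->|ij] := eqVneq i j.
    by rewrite mulr1n.
  by rewrite Qdiag 1?eq_sym.
apply: S_diag => i; rewrite mxE; have := Qs i.
by have [->//|/Qdiag->] := eqVneq (s i) i; rewrite eqxx.
Qed.

End IncidenceElimination.

(** * Regular functions on the automorphism group *)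

Section GeneratedSubgroups.
Variable G : groupType.
Implicit Types H S : set G.

Lemma subgroup_generated_is_subgroup S : is_subgroup (subgroup_generated S).
Proof.
split=> [H [[H1 _] _]//|x y Hx Hy H [Hsub SH]].
by apply: Hsub.2; [apply: Hx|apply: Hy].
Qed.

Lemma is_subgroupV H x : is_subgroup H -> H x -> H (x^-1)%g.
Proof. by case=> H1 HM Hx; rewrite -[(x^-1)%g]mul1g; apply: HM. Qed.

Lemma is_subgroupM H x y : is_subgroup H -> H x -> H y -> H (x * y)%g.
Proof.
by move=> Hsub Hx Hy; rewrite -[y]invgK; apply: Hsub.2 => //; apply: is_subgroupV.
Qed.

End GeneratedSubgroups.

Section LinearAlgebraicGroup.
Variables (k : fieldType) (A : comAlgType k).
Implicit Types (f : alg_aut A -> k) (phi psi : alg_aut A -> alg_aut A).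

Lemma regular_sum (J : Type) (s : seq J) (P : pred J) (f : J -> alg_aut A -> k) :
  (forall j, regular_function (f j)) ->
  regular_function (fun g => \sum_(j <- s | P j) f j g).
Proof.
move=> fr; elim: s => [|j s IH].
  by under eq_fun do rewrite big_nil; apply: regular_const.
under eq_fun do rewrite big_cons.
by case: (P j) => //; apply: regular_add.
Qed.

Lemma regular_scale (c : k) f :
  regular_function f -> regular_function (fun g => c * f g).
Proof. exact/regular_mul/regular_const. Qed.

(** Since the coordinate ring is generated by the matrix coefficients of [g] and
    of its inverse, regularity of a map only has to be tested on those. *)
Definition regular_coefs (phi : alg_aut A -> alg_aut A) : Prop :=
  forall (l : {scalar A}) v, regular_function (fun g => l (phi g v)).

Lemma regular_map_coefs phi : regular_coefs phi ->
  regular_coefs (fun g => (phi g)^-1)%g -> regular_map phi.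
Proof.
move=> r rV f; elim=> [l v|l v|c|f1 f2 _ r1 _ r2|f1 f2 _ r1 _ r2].
- exact: r.
- exact: rV.
- exact: regular_const.
- exact: regular_add.
exact: regular_mul.
Qed.

(** Expanding the inner value in a finite spanning family turns the matrix
    coefficients of a composite into polynomials in those of the factors. *)
Lemma regular_coefs_comp (J : Type) (s : seq J) (e : J -> A)
    (c : J -> {scalar A}) (phi psi : alg_aut A -> alg_aut A) :
  (forall u, u = \sum_(j <- s) c j u *: e j) ->
  regular_coefs phi -> regular_coefs psi ->
  regular_coefs (fun g => (phi g * psi g)%g).
Proof.
move=> uE rphi rpsi l v.
have -> : (fun g => l ((phi g * psi g)%g v)) =
    (fun g => \sum_(j <- s) c j (psi g v) * l (phi g (e j))).
  apply: funext => g; rewrite aut_mulE {1}(uE (psi g v)) !linear_sum.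
  by apply: eq_bigr => j _; rewrite !linearZ.
by apply: regular_sum => j; apply: regular_mul; [apply: rpsi|apply: rphi].
Qed.

Lemma zariski_closed_zeros (J : Type) (f : J -> alg_aut A -> k) :
  (forall j, regular_function (f j)) ->
  zariski_closed [set g | forall j, f j g = 0].
Proof.
move=> fr; exists (range f) => [_ [j _ <-]//|].
by apply/seteqP; split=> [g fg _ [j _ <-]|g fg j] //; apply: fg; exists j.
Qed.

End LinearAlgebraicGroup.

(** The affine line is irreducible, so a set all of whose points are joined to
    the identity by an affine line is connected. *)
Lemma zariski_connected_by_lines (k : closedFieldType) (A : comAlgType k)
    (H : set (alg_aut A)) :
  (forall g, H g -> exists c : k -> alg_aut A,
    [/\ forall t, H (c t), c 0 = 1%g, c 1 = g &
        forall f, regular_function f -> exists p : {poly k},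
          forall t, f (c t) = p.[t]]) ->
  zariski_connected H.
Proof.
move=> curve Z1 Z2 cl1 cl2 HZ HZ0.
suff main Za Zb : zariski_closed Za -> zariski_closed Zb ->
    H `<=` Za `|` Zb -> H `&` Za `&` Zb = set0 -> Za 1%g -> H `<=` Za.
  have [[g Hg]|noH] := pselect (exists g, H g); last first.
    by left=> g Hg; case: noH; exists g.
  have [c [Hc c0 _ _]] := curve g Hg.
  have H1 : H 1%g by rewrite -c0.
  case: (HZ _ H1) => [Z11|Z21]; [left|right].
    exact: (main _ _ cl1 cl2).
  by apply: (main _ _ cl2 cl1) => //; rewrite 1?setUC 1?setIAC.
move=> {Z1 Z2 cl1 cl2 HZ HZ0} [Fa Fareg ->] [Fb Fbreg ->] HZ HZ0 Z1 g Hg f Faf.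
have [c [Hc c0 c1 cpoly]] := curve g Hg.
have [p pE] := cpoly f (Fareg _ Faf).
rewrite -c1 pE; apply/eqP/contraT => p1.
have p_neq0 : p != 0 by apply: contraNneq p1 => ->; rewrite horner0.
suff Zb1 : forall f', Fb f' -> f' 1%g = 0.
  have : (H `&` [set g | forall f, Fa f -> f g = 0] `&`
          [set g | forall f, Fb f -> f g = 0]) 1%g.
    by split=> //; split=> //; rewrite -c0.
  by rewrite HZ0.
move=> f' Fbf'; have [q qE] := cpoly f' (Fbreg _ Fbf').
suff q0 : q = 0 by rewrite -c0 qE q0 horner0.
apply/eqP/contraT => q_neq0.
have /closed_nonrootP[t] : p * q != 0 by rewrite mulf_neq0.
rewrite /root hornerM mulf_eq0 negb_or => /andP[pt qt].
case: (HZ _ (Hc t)) => [/(_ _ Faf)|/(_ _ Fbf')] /eqP.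
  by rewrite pE (negbTE pt).
by rewrite qE (negbTE qt).
Qed.

Lemma derivation1 (k : fieldType) (A : comAlgType k) (D : A -> A) :
  is_derivation D -> D 1 = 0.
Proof.
move=> [_ leibniz]; have := leibniz 1 1; rewrite !mulr1 mul1r => /eqP.
by rewrite addrC -subr_eq subrr eq_sym => /eqP.
Qed.

Section Exponential.
Variables (k : fieldType) (A : comAlgType k).
Hypothesis char0 : [pchar k] =i pred0.
Variables (D : {linear A -> A}) (N : nat).
Hypothesis leibniz : forall x y, D (x * y) = D x * y + x * D y.
Hypothesis nilD : forall x, iter N D x = 0.

Let natf_neq0 n : n.+1%:R != 0 :> k.
Proof. by rewrite ((pcharf0P k).1 char0). Qed.

Let iterD0 n : iter n D 0 = 0.
Proof. by elim: n => //= n ->; rewrite linear0. Qed.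

Let iterD_ge n x : (N <= n)%N -> iter n D x = 0.
Proof. by move=> /subnK <-; rewrite iterD nilD iterD0. Qed.

Let exp_coef n x : A := (n`!%:R)^-1 *: iter n D x.

Let exp_coefS n x : n.+1%:R *: exp_coef n.+1 x = D (exp_coef n x).
Proof.
rewrite /exp_coef [in RHS]linearZ /= scalerA factS natrM invfM mulrA mulfV ?mul1r //.
Qed.

(** The polynomial [exp (D 'X) x], the solution of [p' = D p], [p(0) = x]. *)
Let exp_poly x : {poly A} := \poly_(i < N) exp_coef i x.

Let coef_exp_poly x i : (exp_poly x)`_i = exp_coef i x.
Proof.
rewrite coef_poly; case: ltnP => // /iterD_ge Dx.
by rewrite /exp_coef Dx scaler0.
Qed.

Let exp_poly_unique (p : {poly A}) x : p`_0 = x ->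
  (forall i, p`_i.+1 *+ i.+1 = D p`_i) -> p = exp_poly x.
Proof.
move=> p0 pS; apply/polyP => i; rewrite coef_exp_poly.
elim: i => [|i IH]; first by rewrite p0 /exp_coef fact0 invr1 scale1r.
apply: (scalerI (natf_neq0 i)).
by rewrite exp_coefS -IH -pS scaler_nat.
Qed.

(** Both sides solve the same differential equation, by the Leibniz rule. *)
Let exp_polyM x y : exp_poly (x * y) = exp_poly x * exp_poly y.
Proof.
apply/esym/exp_poly_unique.
  rewrite coefM big_ord_recl big_ord0 addr0 !coef_exp_poly /exp_coef.
  by rewrite fact0 invr1 !scale1r.
move=> i; rewrite -coef_deriv derivM coefD !coefM -big_split linear_sum /=.
apply: eq_bigr => j _; rewrite leibniz !coef_deriv !coef_exp_poly.
by rewrite -!exp_coefS !scaler_nat.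
Qed.

Let expD x : A := \sum_(i < N) exp_coef i x.

Let expDE x : expD x = (exp_poly x).[1].
Proof. by rewrite horner_poly; apply: eq_bigr => i _; rewrite expr1n mulr1. Qed.

Let expD_linear : linear expD.
Proof.
move=> c x y; rewrite /expD scaler_sumr -big_split; apply: eq_bigr => i _ /=.
rewrite /exp_coef; have -> : iter i D (c *: x + y) = c *: iter i D x + iter i D y.
  by elim: {i} (i : nat) => //= i ->; rewrite linearP.
by rewrite scalerDr !scalerA [c * _]mulrC.
Qed.

Let expD_mul : {morph expD : x y / x * y}.
Proof. by move=> x y; rewrite !expDE exp_polyM hornerM. Qed.

Let D1 : D 1 = 0. Proof. by apply: derivation1; split=> //; apply: linearP. Qed.

Let expD1 : expD 1 = 1.
Proof.
rewrite expDE -(@exp_poly_unique 1 1) ?hornerC //; first by rewrite coefC.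
move=> i; rewrite !coef1 /= mul0rn; case: (i == 0)%N => /=; first by rewrite D1.
by rewrite linear0.
Qed.

(** Modulo the image of [D] the exponential is the identity, which lets
    injectivity and surjectivity be read off the kernels of the powers of [D]. *)
Let expD_split x : exists2 y, expD x = x + y &
  forall n, iter n.+1 D x = 0 -> iter n D y = 0.
Proof.
pose T x : A := \sum_(i < N) (i.+1`!%:R)^-1 *: iter i D x.
exists (D (T x)).
  have -> : x + D (T x) = \sum_(i < N.+1) exp_coef i x.
    rewrite big_ord_recl /exp_coef fact0 invr1 scale1r; congr (_ + _).
    by rewrite linear_sum; apply: eq_bigr => i _; rewrite linearZ.
  by rewrite big_ord_recr /= [X in _ + X]/exp_coef nilD scaler0 addr0.
move=> n xn; rewrite -iterSr /T.
have -> m : iter m D (\sum_(i < N) (i.+1`!%:R)^-1 *: iter i D x) =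
    \sum_(i < N) (i.+1`!%:R)^-1 *: iter i D (iter m D x) :> A.
  elim: m => [//|m IH] /=; rewrite IH linear_sum; apply: eq_bigr => i _.
  by rewrite -iterSr linearZ.
by rewrite xn big1 // => i _; rewrite iterD0 scaler0.
Qed.

Let expD_inj : injective expD.
Proof.
suff ker0 x : expD x = 0 -> x = 0.
  move=> x y exy; apply/eqP; rewrite -subr_eq0; apply/eqP/ker0.
  by rewrite -[_ - _]addrC -scaleN1r expD_linear exy scaleN1r addNr.
have [n] : exists n, iter n D x = 0 by exists N.
elim: n x => // n IH x Dx x0; apply: IH => //.
have [y + /(_ n Dx) yn] := expD_split x.
rewrite x0 => /esym/eqP; rewrite addr_eq0 => /eqP ->.
have -> m z : iter m D (- z) = - iter m D z by elim: m => //= m ->; rewrite linearN.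
by rewrite yn oppr0.
Qed.

Let expD_surj y : exists x, expD x = y.
Proof.
have [n] : exists n, iter n D y = 0 by exists N.
elim: n y => [|n IH] y Dy.
  exists 0; rewrite [y]Dy; apply: (addrI (expD 0)).
  by rewrite addr0 -{1}[expD 0]scale1r -expD_linear scale1r addr0.
have [z yz /(_ n Dy) /IH[x xz]] := expD_split y.
by exists (-1 *: x + y); rewrite expD_linear xz yz scaleN1r addrC addrK.
Qed.

(** Multiplicativity of the exponential is the multiplicativity of [exp_poly],
    evaluated at 1. *)
Lemma exponential_exists : exists g : alg_aut A, is_exp D g.
Proof.
have expD_bij : bijective expD.
  pose inv y := sval (cid (expD_surj y)).
  have invK : cancel inv expD by move=> y; exact: svalP (cid (expD_surj y)).
  by exists inv => // x; apply: expD_inj; rewrite invK.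
by exists (MkAlgAut expD_linear expD1 expD_mul expD_bij); exists N.
Qed.

End Exponential.

Section CotangentKernel.
Variables (k : fieldType) (A : comAlgType k) (m : idealr A).
Implicit Types (u v : A) (g : alg_aut A).

(** The square of [m] seen inside of [A], which avoids carrying proofs of
    membership in [m]. *)
Definition in_square u : Prop :=
  exists s : seq (ideal_space m * ideal_space m), u = \sum_(y <- s) val y.1 * val y.2.

Lemma in_square0 : in_square 0.
Proof. by exists [::]; rewrite big_nil. Qed.

Lemma in_square_comb (c : k) u v : in_square u -> in_square v -> in_square (c *: u + v).
Proof.
move=> [s ->] [t ->]; exists ([seq (c *: y.1, y.2) | y <- s] ++ t).
rewrite big_cat big_map scaler_sumr; congr (_ + _).
by apply: eq_bigr => y _; rewrite scalerAl -linearZ.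
Qed.

Lemma in_squareM u v : u \in m -> v \in m -> in_square (u * v).
Proof.
move=> um vm; exists [:: (Sub u um : ideal_space m, Sub v vm : ideal_space m)].
by rewrite big_seq1.
Qed.

Lemma cotangent_kernelP (m_max : the_maximal_ideal m) g :
  cotangent_kernel m_max g <-> forall u, u \in m -> in_square (g u - u).
Proof.
split=> [gU u um|gU].
  pose x : ideal_space m := Sub u um.
  have := congr1 (fun f : GL (cotangent m) => f (\pi_(cotangent m) x)%qT) gU.
  by rewrite /= cotangent_mapE => /cotangent_eq/asboolP; rewrite linearB.
apply: gl_ext => x; elim/quotW: x => x /=.
rewrite cotangent_mapE; apply/cotangent_eq/asboolP; rewrite linearB.
exact/gU/valP.
Qed.

End CotangentKernel.

(** * The monomial basis *)

Definition linear_fun (k : fieldType) (U V : lmodType k) (f : U -> V)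
    (flin : linear f) : {linear U -> V} :=
  HB.pack f (GRing.isLinear.Build k U V *:%R f flin).

Lemma linear_at0 (k : fieldType) (U V : lmodType k) (f : U -> V) :
  linear f -> f 0 = 0.
Proof. by move=> flin; apply: (linear0 (linear_fun flin)). Qed.

(** A class, so that the hypotheses on [I] are found by instance resolution. *)
Class artinian_monomial (k : fieldType) (n : nat) (I : idealr {mpoly k[n]}) : Prop :=
  ArtinianMonomial {
    artinian_monomialI : monomial_ideal I;
    artinian_cofinite : cofinite_support I;
    artinian_variables : forall i : 'I_n, 'X_i \notin I }.

Lemma multinom_split (n : nat) (b : 'X_{1..n}) : (0 < mdeg b)%N ->
  exists i b', b = (U_(i) + b')%MM /\ mdeg b = (mdeg b').+1.
Proof.
move=> b_gt0; have [i bi] : exists i, b i != 0%N.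
  apply/existsP; apply: contraLR b_gt0; rewrite negb_exists => /forallP b0.
  rewrite -eqn0Ngt mdegE big1 // => i _; apply/eqP/negPn/b0.
have bE : b = (U_(i) + (b - U_(i)))%MM by rewrite addmC submK // lep1mP.
by exists i, (b - U_(i))%MM; split; rewrite // {1}bE mdegD mdeg1.
Qed.

Lemma multinom_ind (n : nat) (P : 'X_{1..n} -> Prop) :
  P 0%MM -> (forall i b, P b -> P (U_(i) + b)%MM) -> forall b, P b.
Proof.
move=> P0 PS b; have [d] := ubnP (mdeg b).
elim: d => // d IH in b *; rewrite ltnS => bd.
have [->//|] := eqVneq b 0%MM; rewrite -mdeg_eq0 -lt0n => b_gt0.
have [i [b' [bE bdE]]] := multinom_split b_gt0.
by rewrite bE; apply/PS/IH; rewrite -bdE.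
Qed.

Section MonomialBasis.
Variables (k : fieldType) (n : nat) (I : idealr {mpoly k[n]}).
Context {I_art : artinian_monomial I}.
Local Notation A := (monomial_algebra I).
Implicit Types (b c : 'X_{1..n}) (u v : A) (f : {mpoly k[n]}).

Lemma residue_eq0 f : residue I f = 0 <-> f \in I.
Proof.
rewrite -[f in f \in I]subr0 (Quotient.idealrBE I f 0).
have -> : (0 : A) = (\pi_(alg_quot I) 0)%qT by exact/esym/(rmorph0 (\pi_{ideal_quot I})%qT).
by split=> [fE|/eqP]; first apply/eqP.
Qed.

Lemma residue_linear : linear (residue I).
Proof. by move=> c f g; rewrite /residue alg_quot_piD alg_quot_piZ. Qed.
HB.instance Definition _ :=
  GRing.isLinear.Build k {mpoly k[n]} A *:%R (residue I) residue_linear.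

Lemma residue_multiplicative : monoid_morphism (residue I).
Proof. by split=> [|f g]; rewrite /residue ?alg_quot_pi1 ?alg_quot_piM. Qed.
HB.instance Definition _ :=
  GRing.isMonoidMorphism.Build {mpoly k[n]} A (residue I) residue_multiplicative.

Lemma reprK_residue u : residue I (repr u)%qT = u.
Proof. exact: reprK. Qed.

Definition mon b : A := residue I 'X_[b].

Lemma mon0 : mon 0 = 1.
Proof. by rewrite /mon mpolyX0 rmorph1. Qed.

Lemma monD b c : mon (b + c) = mon b * mon c.
Proof. by rewrite /mon mpolyXD rmorphM. Qed.

Lemma mon_eq0 b : mon b = 0 <-> 'X_[b] \in I.
Proof. exact: residue_eq0. Qed.

Lemma residueE f : residue I f = \sum_(b <- msupp f) f@_b *: mon b.
Proof. by rewrite [f in LHS]mpolyE linear_sum; apply: eq_bigr => b _; rewrite linearZ. Qed.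

Lemma mem_mpolyX_add b c : 'X_[b] \in I -> 'X_[b + c] \in I.
Proof. by rewrite mpolyXD mulrC; apply: idealMr. Qed.

(** A monomial ideal contains every monomial of each of its elements, so the
    coefficients outside of [I] are well defined on the quotient. *)
Lemma mcoeff_ideal f b : f \in I -> 'X_[b] \notin I -> f@_b = 0.
Proof.
move=> /artinian_monomialI[s [sI ->]] bI.
elim: s sI => [|[g c] s IH] sI; first by rewrite big_nil mcoeff0.
rewrite big_cons mcoeffD IH => [|y ys]; last by apply: sI; rewrite inE ys orbT.
rewrite addr0 /=; have [cb|cb] := boolP (c <= b)%MM.
  case/negP: bI; rewrite -(submK cb) addmC mem_mpolyX_add //.
  exact: (sI (g, c) (mem_head _ _)).
rewrite mcoeffM big1 // => -[p q] /= /eqP bE; rewrite mcoeffX.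
case: eqP => [cE|]; last by rewrite mulr0.
by case/negP: cb; rewrite bE cE lem_addl.
Qed.

(** Coordinates on [A] with respect to the monomials outside of [I]; they are
    set to 0 on the monomials of [I], where the coefficient of a representative
    is arbitrary. *)
Definition cf b u : k := if 'X_[b] \in I then 0 else (repr u)%qT@_b.

Lemma cf_residue b f : cf b (residue I f) = if 'X_[b] \in I then 0 else f@_b.
Proof.
rewrite /cf; case: ifP => // /negbT bI; apply/eqP.
rewrite -subr_eq0 -mcoeffB; apply/eqP/mcoeff_ideal => //.
by apply/residue_eq0; rewrite linearB /= reprK_residue subrr.
Qed.

Lemma cf_linear b : linear_for *%R (cf b).
Proof.
move=> c u v; rewrite -[u]reprK_residue -[v]reprK_residue -linearP !cf_residue.
by case: ifP; rewrite ?mulr0 ?addr0 // mcoeffD mcoeffZ.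
Qed.
HB.instance Definition _ b :=
  GRing.isLinear.Build k A k *%R (cf b) (cf_linear b).

(** An enumeration of the exponents of the monomials outside of [I], picked by
    choice because the finiteness of this set is a mere proposition. *)
Definition basis : seq 'X_{1..n} :=
  undup (xget [::] [set s | forall b, (b \in s) = ('X_[b] \notin I)]).

Lemma mem_basis b : (b \in basis) = ('X_[b] \notin I).
Proof.
have [s sE] := (finite_seqP _).1 artinian_cofinite.
rewrite /basis; case: xgetP => [t _ tE|]; first by rewrite mem_undup tE.
move=> /(_ s) []; move=> {}b; apply/idP/idP => [bs|bI].
  by have : [set` s] b by []; rewrite -sE => /negP.
have : (~` supp I) b by apply/negP.
by rewrite sE.
Qed.

Lemma basis_uniq : uniq basis. Proof. exact: undup_uniq. Qed.

Lemma mon_notin_basis b : b \notin basis -> mon b = 0.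
Proof. by rewrite mem_basis negbK => /mon_eq0. Qed.

Lemma cf_mon b c : cf b (mon c) = ((b == c) && (c \in basis))%:R.
Proof.
rewrite cf_residue mcoeffX mem_basis [c == b]eq_sym.
by case: (b =P c) => [->|_] /=; case: ifP.
Qed.

Lemma cf_notin_basis b u : b \notin basis -> cf b u = 0.
Proof. by rewrite mem_basis negbK /cf => ->. Qed.

Lemma basis_expansion u : u = \sum_(b <- basis) cf b u *: mon b.
Proof.
rewrite -[u in LHS]reprK_residue residueE.
rewrite (bigID (fun b => b \in basis)) /= addrC big1 ?add0r => [|b bB]; last first.
  by rewrite mon_notin_basis ?scaler0.
rewrite [RHS](bigID (fun b => b \in msupp (repr u)%qT)) /= [X in _ + X]big1; last first.
  move=> b /memN_msupp_eq0 b0; rewrite -[u]reprK_residue cf_residue b0.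
  by case: ifP; rewrite scale0r.
rewrite addr0 -big_filter -[RHS]big_filter.
rewrite (perm_big [seq b <- basis | b \in msupp (repr u)%qT]); last first.
  apply: uniq_perm; rewrite ?filter_uniq ?msupp_uniq ?basis_uniq // => b.
  by rewrite !mem_filter andbC.
rewrite !big_filter big_seq_cond [RHS]big_seq_cond; apply: eq_bigr => b.
by case/andP; rewrite mem_basis /cf => /negbTE ->.
Qed.

Lemma eq_cf u v : (forall b, b \in basis -> cf b u = cf b v) -> u = v.
Proof.
move=> uv; rewrite [u]basis_expansion [v]basis_expansion !big_seq.
by apply: eq_bigr => b /uv ->.
Qed.

Lemma sum_cf_mon (V : lmodType k) (F : 'X_{1..n} -> V) c : c \in basis ->
  \sum_(b <- basis) cf b (mon c) *: F b = F c.
Proof.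
move=> cB; rewrite (bigD1_seq c) ?basis_uniq //= cf_mon eqxx cB scale1r.
by rewrite big1 ?addr0 // => b /negbTE bc; rewrite cf_mon bc scale0r.
Qed.

Lemma linear_sum_cf (V : lmodType k) (P : pred 'X_{1..n}) (F : 'X_{1..n} -> V) :
  linear (fun u => \sum_(b <- basis | P b) cf b u *: F b).
Proof.
move=> c u v; rewrite scaler_sumr -big_split; apply: eq_bigr => b _ /=.
by rewrite linearP scalerDl scalerA.
Qed.

Lemma linear_mon_ext (V : lmodType k) (f g : A -> V) : linear f -> linear g ->
  (forall b, f (mon b) = g (mon b)) -> f =1 g.
Proof.
move=> lf lg fg u.
rewrite -[f u]/(linear_fun lf u) -[g u]/(linear_fun lg u) [u]basis_expansion !linear_sum.
by apply: eq_bigr => b _; rewrite !linearZ /= fg.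
Qed.

Lemma linear_mon_eq0 (V : lmodType k) (f : A -> V) : linear f ->
  (forall b, f (mon b) = 0) -> forall u, f u = 0.
Proof.
move=> flin; apply: (linear_mon_ext flin (g := fun=> 0)) => c x y.
by rewrite scaler0 addr0.
Qed.

Lemma bilinear_mon_ext (V : lmodType k) (f g : A -> A -> V) :
  (forall v, linear (f^~ v)) -> (forall u, linear (f u)) ->
  (forall v, linear (g^~ v)) -> (forall u, linear (g u)) ->
  (forall b c, f (mon b) (mon c) = g (mon b) (mon c)) ->
  forall u v, f u v = g u v.
Proof.
move=> fl fr gl gr fg u v; apply: (linear_mon_ext (f := f^~ v) (g := g^~ v)) => // b.
exact: linear_mon_ext.
Qed.

End MonomialBasis.

Arguments mon {k n} I b.
Arguments basis {k n} I.
Arguments cf {k n I} b u.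

(** * Homogeneous components of linear maps *)

Section Components.
Variables (k : fieldType) (n : nat) (I : idealr {mpoly k[n]}).
Context {I_art : artinian_monomial I}.
Local Notation A := (monomial_algebra I).
Local Notation mon := (mon I).
Local Notation basis := (basis I).
Implicit Types (b c : 'X_{1..n}) (u v : A).

Lemma derivation_on_monomials (D : A -> A) : linear D ->
  (forall b c, D (mon b * mon c) = D (mon b) * mon c + mon b * D (mon c)) ->
  is_derivation D.
Proof.
move=> Dlin leibniz; split=> // u v.
apply: (bilinear_mon_ext (f := fun u v => D (u * v))
                         (g := fun u v => D u * v + u * D v)) => //=.
- by move=> {}v c x y; rewrite mulrDl -scalerAl Dlin.
- by move=> {}u c x y; rewrite mulrDr -scalerAr Dlin.
- move=> {}v c x y; rewrite Dlin mulrDl -scalerAl [(_ + y) * _]mulrDl -scalerAl.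
  by rewrite scalerDr addrACA.
move=> {}u c x y; rewrite Dlin mulrDr -scalerAr [u * (_ + D y)]mulrDr -scalerAr.
by rewrite scalerDr addrACA.
Qed.

Variables (V : zmodType) (wt : 'X_{1..n} -> V).
Implicit Types (z a : V).

Definition proj z u : A := \sum_(b <- basis | wt b == z) cf b u *: mon b.

Lemma proj_linear z : linear (proj z). Proof. exact: linear_sum_cf. Qed.
HB.instance Definition _ z := GRing.isLinear.Build k A A *:%R (proj z) (proj_linear z).

Lemma cf_proj z u b : cf b (proj z u) = if wt b == z then cf b u else 0.
Proof.
have [bB|bB] := boolP (b \in basis); last by rewrite !cf_notin_basis ?if_same.
rewrite /proj big_mkcond linear_sum (bigD1_seq b) ?basis_uniq //=.
rewrite big1 => [|c cb]; last first.
  by case: ifP => _; rewrite ?linear0 // linearZ /= cf_mon eq_sym (negbTE cb) mulr0.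
by case: ifP => _; rewrite ?linear0 ?addr0 // linearZ /= cf_mon eqxx bB mulr1.
Qed.

Lemma proj_mon z b : proj z (mon b) = if wt b == z then mon b else 0.
Proof.
apply: eq_cf => c _; rewrite cf_proj [RHS]fun_if linear0 !cf_mon.
have [->//|cb] := eqVneq c b.
by rewrite !if_same.
Qed.

(** The homogeneous part of degree [a], for the grading by [wt], of the linear
    map that agrees with [phi] on monomials. *)
Definition component a (phi : A -> A) u : A :=
  \sum_(b <- basis) cf b u *: proj (wt b + a) (phi (mon b)).

Lemma component_linear a phi : linear (component a phi).
Proof. exact: linear_sum_cf. Qed.
HB.instance Definition _ a phi :=
  GRing.isLinear.Build k A A *:%R (component a phi) (component_linear a phi).

Lemma component_mon a phi b : phi 0 = 0 ->
  component a phi (mon b) = proj (wt b + a) (phi (mon b)).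
Proof.
move=> phi0; have [bB|bB] := boolP (b \in basis).
  by rewrite /component (sum_cf_mon (fun b => proj (wt b + a) (phi (mon b)))).
by rewrite mon_notin_basis // linear0 phi0 linear0.
Qed.

Lemma cf_component_mon a phi b c : phi 0 = 0 ->
  cf c (component a phi (mon b)) =
  if wt c == wt b + a then cf c (phi (mon b)) else 0.
Proof. by move=> phi0; rewrite component_mon // cf_proj. Qed.

Lemma sum_component (s : seq V) (phi : A -> A) : linear phi -> uniq s ->
  (forall b c, b \in basis -> c \in basis -> wt c - wt b \in s) ->
  forall u, phi u = \sum_(a <- s) component a phi u.
Proof.
move=> philin s_uniq s_wt.
have phi0 : phi 0 = 0.
  by apply: (addIr (phi 0)); rewrite -{1}[phi 0]scale1r -philin scaler0 !addr0 add0r.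
apply: linear_mon_ext => // [c x y|b].
  by rewrite scaler_sumr -big_split; apply: eq_bigr => a _; rewrite linearP.
have [bB|bB] := boolP (b \in basis); last first.
  by rewrite mon_notin_basis // phi0 big1 // => a _; rewrite linear0.
apply: eq_cf => c cB; rewrite linear_sum /=.
rewrite (bigD1_seq (wt c - wt b)) ?s_wt //= cf_component_mon // [wt b + _]addrC subrK eqxx.
rewrite big1 ?addr0 // => a; rewrite cf_component_mon // => ab.
case: eqP => // cE; case/eqP: ab.
by rewrite cE addrC addKr.
Qed.

Hypothesis wtD : {morph wt : b c / (b + c)%MM >-> b + c}.

Lemma proj_mul_mon z u c : proj (z + wt c) (u * mon c) = proj z u * mon c.
Proof.
apply: (linear_mon_ext (f := fun u => proj (z + wt c) (u * mon c))
                       (g := fun u => proj z u * mon c)) => [d x y|d x y|b].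
- by rewrite mulrDl -scalerAl linearP.
- by rewrite linearP mulrDl -scalerAl.
rewrite -monD !proj_mon wtD (inj_eq (addIr _)).
by case: ifP => _; rewrite ?mul0r ?monD.
Qed.

(** Multiplying by a monomial translates the weights, so the Leibniz rule holds
    weight by weight. *)
Lemma component_derivation a D : is_derivation D -> is_derivation (component a D).
Proof.
move=> [Dlin leibniz]; have D0 : D 0 = 0.
  by rewrite -[X in D X](mulr0 0) leibniz mulr0 mul0r addr0.
apply: derivation_on_monomials => [|b c]; first exact: linearP.
rewrite -monD !component_mon // monD leibniz linearD /= wtD.
rewrite addrAC proj_mul_mon; congr (_ + _).
by rewrite addrAC -addrA [wt b + _]addrC [mon b * D _]mulrC proj_mul_mon mulrC.
Qed.

End Components.

(** * The filtration by order *)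

Section Filtration.
Variables (k : fieldType) (n : nat) (I : idealr {mpoly k[n]}).
Context {I_art : artinian_monomial I}.
Local Notation A := (monomial_algebra I).
Local Notation mon := (mon I).
Local Notation basis := (basis I).
Implicit Types (b c : 'X_{1..n}) (u v : A) (d e : nat).

Definition tdeg b : int := (mdeg b)%:Z.

(** The filtration of [A] by the powers of its maximal ideal. *)
Definition order_ge d u : Prop := forall b, (mdeg b < d)%N -> cf b u = 0.

Lemma order_geW d e u : (d <= e)%N -> order_ge e u -> order_ge d u.
Proof. by move=> de ue b bd; apply: ue; apply: leq_trans de. Qed.

Lemma order_ge0 d : order_ge d 0.
Proof. by move=> b _; rewrite linear0. Qed.

Lemma order_ge_comb d (c : k) u v : order_ge d u -> order_ge d v -> order_ge d (c *: u + v).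
Proof. by move=> ud vd b bd; rewrite linearP /= ud // vd // mulr0 addr0. Qed.

Lemma order_geD d u v : order_ge d u -> order_ge d v -> order_ge d (u + v).
Proof. by rewrite -{2}[u]scale1r; apply: order_ge_comb. Qed.

Lemma order_geZ d (c : k) u : order_ge d u -> order_ge d (c *: u).
Proof. by move=> ud; rewrite -[_ *: _]addr0; apply/order_ge_comb/order_ge0. Qed.

Lemma order_geN d u : order_ge d u -> order_ge d (- u).
Proof. by rewrite -scaleN1r; apply: order_geZ. Qed.

Lemma order_geB d u v : order_ge d u -> order_ge d v -> order_ge d (u - v).
Proof. by move=> ud vd; apply/order_geD/order_geN. Qed.

Lemma order_ge_sum d (J : Type) (s : seq J) (P : pred J) (F : J -> A) :
  (forall j, P j -> order_ge d (F j)) -> order_ge d (\sum_(j <- s | P j) F j).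
Proof. by move=> h; elim/big_ind: _ => //; [exact: order_ge0|exact: order_geD]. Qed.

Lemma order_ge_mon d b : (d <= mdeg b)%N -> order_ge d (mon b).
Proof.
move=> db c cd; rewrite cf_mon; case: eqP => // cb.
by rewrite cb ltnNge db in cd.
Qed.

Lemma order_ge_ind d (P : A -> Prop) : P 0 ->
  (forall (c : k) u v, P u -> P v -> P (c *: u + v)) ->
  (forall b, (d <= mdeg b)%N -> P (mon b)) ->
  forall u, order_ge d u -> P u.
Proof.
move=> P0 PP Pmon u ud; rewrite [u]basis_expansion.
have PD x y : P x -> P y -> P (x + y) by move=> Px Py; rewrite -[x]scale1r; apply: PP.
elim/big_ind: _ => // b _; have [db|bd] := leqP d (mdeg b).
  by rewrite -[_ *: _]addr0; apply: PP => //; apply: Pmon.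
by rewrite ud // scale0r.
Qed.

Lemma order_geM d e u v : order_ge d u -> order_ge e v -> order_ge (d + e) (u * v).
Proof.
move=> ud ve; move: u ud; apply: order_ge_ind => [|c x y|b db].
- by rewrite mul0r; apply: order_ge0.
- by rewrite mulrDl -scalerAl; apply: order_ge_comb.
move: v ve; apply: order_ge_ind => [|c x y|c ec].
- by rewrite mulr0; apply: order_ge0.
- by rewrite mulrDr -scalerAr; apply: order_ge_comb.
by rewrite -monD; apply: order_ge_mon; rewrite mdegD leq_add.
Qed.

Lemma order_ge_top : exists d, forall u, order_ge d u -> u = 0.
Proof.
exists (\max_(b <- basis) (mdeg b).+1)%N => u ud.
apply: eq_cf => b bB; rewrite linear0 ud //.
by rewrite (bigD1_seq b) ?basis_uniq //= leq_max leqnn.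
Qed.

(** Homogeneous components for the total degree. *)
Definition gr d : A -> A := proj tdeg d%:Z.
HB.instance Definition _ d := GRing.Linear.on (gr d).

Lemma gr_mon d b : gr d (mon b) = if mdeg b == d then mon b else 0.
Proof. exact: proj_mon. Qed.

Lemma cf_gr d u b : cf b (gr d u) = if mdeg b == d then cf b u else 0.
Proof. exact: cf_proj. Qed.

Lemma order_ge_gr d u : order_ge d (gr d u).
Proof. by move=> b bd; rewrite cf_gr ltn_eqF. Qed.

Lemma order_ge_gr_eq0 d e u : (d < e)%N -> order_ge e u -> gr d u = 0.
Proof.
move=> de ue; apply: eq_cf => b _; rewrite cf_gr linear0.
by case: eqP => // bd; apply: ue; rewrite bd.
Qed.

Lemma order_geS d u : order_ge d u -> gr d u = 0 -> order_ge d.+1 u.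
Proof.
move=> ud u0 b; rewrite ltnS leq_eqVlt => /predU1P[bd|/ud//].
by have := congr1 (cf b) u0; rewrite cf_gr bd eqxx linear0.
Qed.

Lemma order_ge_subgr d u : order_ge d u -> order_ge d.+1 (u - gr d u).
Proof.
move=> ud; apply: order_geS; first exact/order_geB/order_ge_gr.
rewrite linearB /=; apply: eq_cf => b _; rewrite linearB /= !cf_gr linear0.
by case: eqP; rewrite ?subrr.
Qed.

Lemma gr_mul d e u v : order_ge d u -> order_ge e v ->
  gr (d + e) (u * v) = gr d u * gr e v.
Proof.
move=> ud ve; move: u ud; apply: order_ge_ind => [|a x y xE yE|b db].
- by rewrite mul0r !linear0 mul0r.
- by rewrite mulrDl -scalerAl [LHS]linearP [gr d (_ + y)]linearP /= xE yE mulrDl -scalerAl.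
move: v ve; apply: order_ge_ind => [|a x y xE yE|c ec].
- by rewrite mulr0 !linear0 mulr0.
- by rewrite mulrDr -scalerAr [LHS]linearP [gr e (_ + y)]linearP /= xE yE mulrDr -scalerAr.
rewrite -monD !gr_mon mdegD.
case: (mdeg b =P d) => [->|/eqP bd]; last first.
  by rewrite mul0r gtn_eqF // -addSn leq_add // ltn_neqAle eq_sym bd.
rewrite eqn_add2l; case: eqP => _; first by rewrite monD.
by rewrite mulr0.
Qed.

Lemma cf0_mon b : cf 0%MM (mon b) = (b == 0%MM)%:R.
Proof.
rewrite cf_mon eq_sym; case: eqP => //= ->.
by rewrite mem_basis mpolyX0 idealr1.
Qed.

Lemma cf0M u v : cf 0%MM (u * v) = cf 0%MM u * cf 0%MM v.
Proof.
apply: (bilinear_mon_ext (f := fun u v => cf 0%MM (u * v) : k^o)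
                         (g := fun u v => cf 0%MM u * cf 0%MM v : k^o)) => /=.
- by move=> {}v c x y; rewrite mulrDl -scalerAl linearP.
- by move=> {}u c x y; rewrite mulrDr -scalerAr linearP.
- by move=> {}v c x y; rewrite linearP mulrDl scalerAl.
- by move=> {}u c x y; rewrite linearP mulrDr scalerAr.
move=> b c; rewrite -monD !cf0_mon -natrM mulnb.
by rewrite -!mdeg_eq0 mdegD addn_eq0.
Qed.

Lemma order_ge1 u : order_ge 1 u <-> cf 0%MM u = 0.
Proof.
split=> [->//|u0 b]; first by rewrite mdeg0.
by rewrite ltnS leqn0 mdeg_eq0 => /eqP ->.
Qed.

Lemma order_geX d u i : order_ge d u -> order_ge (i * d) (u ^+ i).
Proof. by move=> ud; elim: i => // i IH; rewrite exprS mulSn; apply: order_geM. Qed.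

(** This makes the filtration intrinsic, hence stable under automorphisms. *)
Lemma order_ge1_nilpotent u : order_ge 1 u <-> exists i, u ^+ i = 0.
Proof.
split=> [u1|[i]].
  have [d dP] := order_ge_top; exists d; apply: dP.
  by rewrite -[d in order_ge d _]muln1; apply: order_geX.
move=> ui; apply/order_ge1/eqP.
have : cf 0%MM (u ^+ i) = 0 by rewrite ui linear0.
suff -> : cf 0%MM (u ^+ i) = cf 0%MM u ^+ i by move/eqP; rewrite expf_eq0 => /andP[].
elim: i {ui} => [|i IH]; last by rewrite !exprS cf0M IH.
by rewrite !expr0 -(mon0 I) cf0_mon eqxx.
Qed.

Lemma aut_order_ge (g : alg_aut A) d u : order_ge d u -> order_ge d (g u).
Proof.
have g1 x : order_ge 1 x -> order_ge 1 (g x).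
  move=> /order_ge1_nilpotent[i xi]; apply/order_ge1_nilpotent; exists i.
  by rewrite -rmorphXn xi rmorph0.
move: u; apply: order_ge_ind => [|c x y|b]; first by rewrite linear0; apply: order_ge0.
  by rewrite linearP; apply: order_ge_comb.
move=> db; apply: order_geW db _; elim/multinom_ind: b => [|i b IH].
  by rewrite mdeg0.
rewrite monD rmorphM mdegD; apply: order_geM => //; rewrite mdeg1.
by apply/g1/order_ge_mon; rewrite mdeg1.
Qed.

End Filtration.
Arguments tdeg {n} b.

(** * The linear part of an automorphism *)

Section LinearPart.
Variables (k : fieldType) (n : nat) (I : idealr {mpoly k[n]}).
Context {I_art : artinian_monomial I}.
Local Notation A := (monomial_algebra I).
Local Notation mon := (mon I).
Local Notation basis := (basis I).
Implicit Types (b c : 'X_{1..n}) (u v : A) (d e : nat) (g h : alg_aut A).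

Definition graded_map g : A -> A := component tdeg 0 g.
HB.instance Definition _ g := GRing.Linear.on (graded_map g).

Lemma graded_map_mon g b : graded_map g (mon b) = gr (mdeg b) (g (mon b)).
Proof. by rewrite /graded_map component_mon ?addr0 // linear0. Qed.

Lemma graded_map_gr g d u : graded_map g (gr d u) = gr d (g (gr d u)).
Proof.
apply: (linear_mon_ext (f := fun u => graded_map g (gr d u))
          (g := fun u => gr d (g (gr d u)))) => [a x y|a x y|b].
- by rewrite !linearP.
- by rewrite !linearP.
rewrite gr_mon; case: eqP => [<-|_]; first by rewrite graded_map_mon.
by rewrite !linear0.
Qed.

(** The terms of [u] of degree more than [d] do not contribute, as [g] cannot
    lower their order. *)
Lemma gr_aut_gr g d u : order_ge d u -> gr d (g (gr d u)) = gr d (g u).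
Proof.
move=> ud; rewrite -[u in RHS](subrK (gr d u)) [g (_ + _)]linearD linearD /=.
rewrite [X in _ = X + _](order_ge_gr_eq0 (ltnSn d)) ?add0r //.
exact/aut_order_ge/order_ge_subgr.
Qed.

Lemma graded_mapM g h u : graded_map (g * h)%g u = graded_map g (graded_map h u).
Proof.
apply: (linear_mon_ext (f := graded_map (g * h)%g)
          (g := fun u => graded_map g (graded_map h u))) => [a x y|a x y|b].
- by rewrite linearP.
- by rewrite !linearP.
rewrite !graded_map_mon graded_map_gr gr_aut_gr //.
exact/aut_order_ge/order_ge_mon.
Qed.

Lemma graded_map1 u : graded_map 1%g u = u.
Proof.
apply: (linear_mon_ext (f := graded_map 1%g) (g := id)) => [a x y|//|b].
  by rewrite linearP.
by rewrite graded_map_mon gr_mon eqxx.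
Qed.

Fact graded_map_linear g : linear (graded_map g). Proof. exact: linearP. Qed.

Fact graded_map_one g : graded_map g 1 = 1.
Proof. by rewrite -(mon0 I) graded_map_mon mon0 rmorph1 -(mon0 I) gr_mon eqxx. Qed.

Fact graded_map_mul g : {morph graded_map g : u v / u * v}.
Proof.
apply: (bilinear_mon_ext (f := fun u v => graded_map g (u * v))
          (g := fun u v => graded_map g u * graded_map g v)) => /=.
- by move=> v a x y; rewrite mulrDl -scalerAl linearP.
- by move=> u a x y; rewrite mulrDr -scalerAr linearP.
- by move=> v a x y; rewrite linearP mulrDl scalerAl.
- by move=> u a x y; rewrite linearP mulrDr scalerAr.
move=> b c; rewrite -monD !graded_map_mon mdegD monD rmorphM gr_mul //;
  exact/aut_order_ge/order_ge_mon.
Qed.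

Fact graded_map_bij g : bijective (graded_map g).
Proof.
by exists (graded_map (g^-1)%g) => u;
  rewrite -graded_mapM ?mulVg ?mulgV graded_map1.
Qed.

(** The automorphism induced by [g] on the associated graded ring of the
    filtration by powers of the maximal ideal, which is [A] again because [I]
    is homogeneous: the substitution of the linear parts of the [g x_i]. *)
Definition linear_part g : alg_aut A :=
  MkAlgAut (graded_map_linear g) (graded_map_one g) (graded_map_mul g)
    (graded_map_bij g).

Lemma linear_partM g h : linear_part (g * h)%g = (linear_part g * linear_part h)%g.
Proof. by apply: aut_ext => u; apply: graded_mapM. Qed.

Lemma linear_part1 : linear_part 1%g = 1%g.
Proof. by apply: aut_ext => u; apply: graded_map1. Qed.

Lemma linear_partV g : linear_part (g^-1)%g = ((linear_part g)^-1)%g.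
Proof.
by rewrite -[RHS]mulg1 -linear_part1 -(mulgV g) linear_partM mulKg.
Qed.

Lemma linear_part_mon g b : linear_part g (mon b) = gr (mdeg b) (g (mon b)).
Proof. exact: graded_map_mon. Qed.

Lemma linear_part_id g : linear_part (linear_part g) = linear_part g.
Proof.
apply: aut_ext; apply: linear_mon_ext; try exact: linearP.
move=> b; rewrite !linear_part_mon; apply: eq_cf => c _; rewrite !cf_gr.
by case: (mdeg c == mdeg b).
Qed.

(** The matrix of the linear part consists of the diagonal blocks, for the
    grading by total degree, of the matrix of [g]. *)
Lemma regular_coefs_linear_part (phi : alg_aut A -> alg_aut A) :
  regular_coefs phi -> regular_coefs (fun g => linear_part (phi g)).
Proof.
move=> phiR l v.
have -> : (fun g => l (linear_part (phi g) v)) =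
    (fun g => \sum_(b <- basis) cf b v * l (gr (mdeg b) (phi g (mon b)))).
  apply: funext => g; rewrite -[linear_part _ v]/(component tdeg 0 _ v) linear_sum.
  by apply: eq_bigr => b _; rewrite linearZ addr0.
apply: regular_sum => b; apply: regular_scale.
exact: (phiR (l \o gr (mdeg b))).
Qed.

Let coefs_id : regular_coefs (@id (alg_aut A)).
Proof. by move=> l v; apply: regular_coef. Qed.

Let coefs_inv : regular_coefs (fun g : alg_aut A => g^-1)%g.
Proof. by move=> l v; apply: regular_coefV. Qed.

Lemma regular_linear_part : regular_map linear_part.
Proof.
apply: regular_map_coefs; first exact: regular_coefs_linear_part.
have -> : (fun g => (linear_part g)^-1)%g = (fun g => linear_part g^-1)%g.
  by apply: funext => g; rewrite linear_partV.
exact: regular_coefs_linear_part.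
Qed.

(** The projection on the normal factor of the semidirect product. *)
Definition unipotent_part g : alg_aut A := (g * (linear_part g)^-1)%g.

Lemma regular_unipotent_part : regular_map unipotent_part.
Proof.
have uE := @basis_expansion _ _ I I_art.
apply: regular_map_coefs.
  have -> : unipotent_part = (fun g => g * linear_part g^-1)%g.
    by apply: funext => g; rewrite linear_partV.
  apply: (@regular_coefs_comp _ _ _ _ _ (fun b => cf b : {scalar A})
    id (fun g => linear_part g^-1)%g uE) => //.
  exact: regular_coefs_linear_part.
have -> : (fun g => (unipotent_part g)^-1)%g = (fun g => linear_part g * g^-1)%g.
  by apply: funext => g; rewrite /unipotent_part invgM invgK.
apply: (@regular_coefs_comp _ _ _ _ _ (fun b => cf b : {scalar A})
  linear_part (fun g => g^-1)%g uE) => //.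
exact: regular_coefs_linear_part.
Qed.

End LinearPart.

(** * The filtration of the automorphism group *)

Section UnipotentFiltration.
Variables (k : fieldType) (n : nat) (I : idealr {mpoly k[n]}).
Context {I_art : artinian_monomial I}.
Local Notation A := (monomial_algebra I).
Local Notation mon := (mon I).
Local Notation basis := (basis I).
Implicit Types (b c : 'X_{1..n}) (u v : A) (d e : nat) (g h : alg_aut A).

(** The automorphisms congruent to 1 in degree [d] of the filtration: [raises 1]
    will be the unipotent kernel, which these subgroups filter. *)
Definition raises d : set (alg_aut A) :=
  [set g | forall e u, order_ge e u -> order_ge (e + d) (g u - u)].

Lemma raises_mon d g :
  (forall b, order_ge (mdeg b + d) (g (mon b) - mon b)) -> raises d g.
Proof.
move=> gmon e; apply: order_ge_ind => [|a u v ud vd|b eb].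
- by rewrite linear0 subrr; apply: order_ge0.
- by rewrite linearP opprD addrACA -scalerBr; apply: order_ge_comb.
by apply: order_geW (gmon b); rewrite leq_add2r.
Qed.

(** The generators suffice because [g (u v) - u v] is
    [(g u - u) g v + u (g v - v)]. *)
Lemma raises_variables d g :
  (forall i, order_ge d.+1 (g (mon U_(i)) - mon U_(i))) -> raises d g.
Proof.
move=> gvar; apply: raises_mon => b; elim/multinom_ind: b => [|i b IH].
  by rewrite mon0 rmorph1 subrr; apply: order_ge0.
rewrite monD rmorphM.
have -> : g (mon U_(i)) * g (mon b) - mon U_(i) * mon b =
   (g (mon U_(i)) - mon U_(i)) * g (mon b) + mon U_(i) * (g (mon b) - mon b).
  by rewrite mulrBl mulrBr addrA subrK.
rewrite mdegD mdeg1; apply: order_geD.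
  rewrite addnAC add1n; apply: order_geM => //.
  exact/aut_order_ge/order_ge_mon.
by rewrite -addnA; apply: order_geM => //; apply: order_ge_mon; rewrite mdeg1.
Qed.

Lemma raises_subgroup d : is_subgroup (raises d).
Proof.
have rV g : raises d g -> raises d (g^-1)%g.
  move=> gd e u ue; rewrite -[X in _ - X](aut_mulKV g) -opprB.
  by apply/order_geN/gd/aut_order_ge.
split=> [e u _|g h gd /rV hd e u ue]; first by rewrite subrr; apply: order_ge0.
rewrite aut_mulE -[X in X - _](subrK ((h^-1)%g u)) -addrA.
by apply: order_geD; [apply/gd/aut_order_ge|apply: hd].
Qed.

Lemma raisesW d e g : (d <= e)%N -> raises e g -> raises d g.
Proof. by move=> de ge i u /ge; apply: order_geW; rewrite leq_add2l. Qed.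

Lemma raises_top : exists d, forall g, raises d g -> g = 1%g.
Proof.
have [d dP] := @order_ge_top _ _ I I_art; exists d => g gd.
by apply: aut_ext => u; apply/eqP; rewrite -subr_eq0; apply/eqP/dP/(gd 0%N).
Qed.

Lemma raises1_linear_part g : raises 1 g <-> linear_part g = 1%g.
Proof.
split=> [g1|gl].
  apply: aut_ext; apply: linear_mon_ext; try exact: linearP.
  move=> b; rewrite linear_part_mon /= -[g _](subrK (mon b)) linearD /= gr_mon eqxx.
  rewrite (order_ge_gr_eq0 (ltnSn _)) ?add0r // -addn1.
  exact/g1/order_ge_mon.
apply: raises_mon => b; rewrite addn1; apply: order_geS.
  by apply: order_geB; [apply: aut_order_ge|]; apply: order_ge_mon.
by rewrite linearB /= -linear_part_mon gl gr_mon eqxx subrr.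
Qed.

Lemma raises1_gr b g : raises 1 g -> gr (mdeg b) (g (mon b)) = mon b.
Proof. by move/raises1_linear_part=> g1; rewrite -linear_part_mon g1. Qed.

Lemma raises1_unipotent : unipotent_subset (raises 1).
Proof.
move=> g g1; have [d dP] := @order_ge_top _ _ I I_art; exists d => x; apply: dP.
elim: d => [|d IH] //=; first by rewrite -addn1; apply: g1.
Qed.

(** The leading term of [g - 1] in the filtration by order. *)
Definition leading d g : A -> A := component tdeg d%:Z (fun u => g u - u).

Lemma leading_mon d g b : leading d g (mon b) = gr (mdeg b + d) (g (mon b) - mon b).
Proof. by rewrite /leading component_mon // linear0 subrr. Qed.

Lemma leading_linear d g : linear (leading d g). Proof. exact: linearP. Qed.

(** The defect [(g u - u) (g v - v)] in the Leibniz rule has its order raised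
    twice, so it does not reach the leading term. *)
Lemma leading_derivation d g : raises d.+1 g -> is_derivation (leading d.+1 g).
Proof.
move=> gd; apply: derivation_on_monomials => [|b c]; first exact: leading_linear.
rewrite -monD !leading_mon monD rmorphM.
have -> : g (mon b) * g (mon c) - mon b * mon c =
   (g (mon b) - mon b) * g (mon c) + mon b * (g (mon c) - mon c).
  by rewrite mulrBl mulrBr addrA subrK.
rewrite linearD /= mdegD; congr (_ + _).
  rewrite addnAC gr_mul; first last.
  - exact/aut_order_ge/order_ge_mon.
  - exact/gd/order_ge_mon.
  by congr (_ * _); apply/raises1_gr/raisesW/gd.
rewrite -addnA gr_mul ?gr_mon ?eqxx //; first exact: order_ge_mon.
exact/gd/order_ge_mon.
Qed.

(** Likewise [g w - w], for [w = h u - u], is negligible. *)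
Lemma leadingM d g h : raises d.+1 g -> raises d.+1 h ->
  forall u, leading d.+1 (g * h)%g u = leading d.+1 g u + leading d.+1 h u.
Proof.
move=> gd hd; apply: linear_mon_ext; first exact: leading_linear.
  by move=> a x y; rewrite !leading_linear scalerDr addrACA.
move=> b; rewrite !leading_mon -linearD /=.
pose w := h (mon b) - mon b.
have -> : g (h (mon b)) - mon b =
    (g w - w) + (g (mon b) - mon b + (h (mon b) - mon b)).
  rewrite -/w {1}[h (mon b)](_ : _ = w + mon b); last by rewrite subrK.
  by rewrite [in LHS]linearD /= [_ - mon b + w]addrC addrA subrK addrA.
rewrite linearD /= [X in X + _ = _](order_ge_gr_eq0 (e := mdeg b + d.+1 + d.+1)) ?add0r //.
  by rewrite -[X in (X < _)%N]addn0 ltn_add2l.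
exact/gd/hd/order_ge_mon.
Qed.

Lemma raisesS d g : raises d g -> (forall u, leading d g u = 0) -> raises d.+1 g.
Proof.
move=> gd g0; apply: raises_mon => b; rewrite addnS; apply: order_geS.
  exact/gd/order_ge_mon.
by rewrite -leading_mon.
Qed.

Section Cotangent.
Variables (m : idealr A) (m_max : the_maximal_ideal m).

(** The constant term is a morphism onto the field [k], so its kernel is a
    maximal ideal. *)
Lemma maximal_idealE u : u \in m <-> order_ge 1 u.
Proof.
have Jid : idealr_closed (fun u : A => cf 0%MM u == 0).
  split=> [||a u' v']; rewrite -topredE /=.
  - by rewrite linear0.
  - by rewrite -(mon0 I) cf0_mon eqxx oner_eq0.
  by rewrite -!topredE /= => /eqP u0 /eqP v0; rewrite linearD /= cf0M u0 v0 mulr0 addr0.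
pose J1 := isIdealr.Build A (fun u : A => cf 0%MM u == 0) Jid.
pose J := HB.pack_for (idealr A) (fun u : A => cf 0%MM u == 0) J1.
have memJ x : (x \in J) = (cf 0%MM x == 0) by [].
rewrite order_ge1 -(m_max.2 J) ?memJ; first by split=> /eqP.
move=> J' JJ' y yJ'; rewrite memJ; apply: contraT => y0.
suff : 1 \in J' by rewrite idealr1.
have -> : 1 = (cf 0%MM y)^-1 *: y + (1 - (cf 0%MM y)^-1 *: y).
  by rewrite addrC subrK.
apply: rpredD; first by rewrite -[y]mul1r scalerAl idealMr.
apply: JJ'; rewrite memJ linearB linearZ /= mulVf // -(mon0 I) cf0_mon eqxx.
by rewrite subrr.
Qed.

Lemma in_square_order_ge2 u : in_square m u <-> order_ge 2 u.
Proof.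
split=> [[s ->]|].
  apply: order_ge_sum => y _.
  by apply: (order_geM (d := 1) (e := 1)); apply/maximal_idealE/valP.
move: u; apply: order_ge_ind; [exact: in_square0|exact: in_square_comb|move=> b b2].
have [i [b' [bE bd]]] := multinom_split (ltnW b2).
rewrite bE monD; apply: in_squareM; apply/maximal_idealE/order_ge_mon.
  by rewrite mdeg1.
by rewrite -ltnS -bd.
Qed.

Lemma cotangent_kernelE : cotangent_kernel m_max = raises 1.
Proof.
apply/seteqP; split=> g.
  move=> /cotangent_kernelP gU; apply: raises_variables => i.
  by apply/in_square_order_ge2/gU/maximal_idealE/order_ge_mon; rewrite mdeg1.
move=> g1; apply/cotangent_kernelP => u /maximal_idealE um.
exact/in_square_order_ge2/(g1 1%N).
Qed.

End Cotangent.
End UnipotentFiltration.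

(** * The torus, Zariski-closedness and connectedness *)

Section TorusAction.
Variables (k : fieldType) (n : nat) (I : idealr {mpoly k[n]}).
Context {I_art : artinian_monomial I}.
Local Notation A := (monomial_algebra I).
Local Notation mon := (mon I).
Local Notation basis := (basis I).

Definition torus_map (t : 'I_n -> k) (u : A) : A :=
  \sum_(b <- basis) cf b u *: ((\prod_i t i ^+ b i) *: mon b).

Fact torus_map_linear t : linear (torus_map t). Proof. exact: linear_sum_cf. Qed.
HB.instance Definition _ t := GRing.isLinear.Build k A A *:%R (torus_map t) (torus_map_linear t).

Lemma torus_map_mon t b : torus_map t (mon b) = (\prod_i t i ^+ b i) *: mon b.
Proof.
have [bB|bB] := boolP (b \in basis).
  by rewrite /torus_map (sum_cf_mon (fun b => _ *: mon b)).
by rewrite mon_notin_basis // linear0 scaler0.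
Qed.

Fact torus_map1 t : torus_map t 1 = 1.
Proof.
rewrite -(mon0 I) torus_map_mon big1 ?scale1r // => i _.
by rewrite mnm0E expr0.
Qed.

Fact torus_map_mul t : {morph torus_map t : u v / u * v}.
Proof.
apply: (bilinear_mon_ext (f := fun u v => torus_map t (u * v))
          (g := fun u v => torus_map t u * torus_map t v)) => /=.
- by move=> v a x y; rewrite mulrDl -scalerAl linearP.
- by move=> u a x y; rewrite mulrDr -scalerAr linearP.
- by move=> v a x y; rewrite linearP mulrDl scalerAl.
- by move=> u a x y; rewrite linearP mulrDr scalerAr.
move=> b c; rewrite -monD !torus_map_mon -scalerAl -scalerAr scalerA -monD.
by rewrite -big_split; congr (_ *: _); apply: eq_bigr => i _; rewrite mnmDE exprD.
Qed.

Lemma torus_mapK t t' : (forall i, t' i * t i = 1) -> cancel (torus_map t) (torus_map t').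
Proof.
move=> tt' u; move: u.
apply: (linear_mon_ext (f := fun u => torus_map t' (torus_map t u)) (g := id)) => //.
  by move=> a x y; rewrite !linearP.
move=> b; rewrite torus_map_mon linearZ /= torus_map_mon scalerA mulrC -big_split.
by rewrite big1 ?scale1r // => i _; rewrite /= -exprMn tt' expr1n.
Qed.

Lemma torus_element (t : 'I_n -> k) : (forall i, t i != 0) ->
  exists g : alg_aut A, forall b, g (mon b) = (\prod_i t i ^+ b i) *: mon b.
Proof.
move=> t0; have t_bij : bijective (torus_map t).
  by exists (torus_map (fun i => (t i)^-1)); apply: torus_mapK => i;
    rewrite ?mulVf ?mulfV.
exists (MkAlgAut (torus_map_linear t) (torus_map1 t) (@torus_map_mul t) t_bij).
exact: torus_map_mon.
Qed.

End TorusAction.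

Section ZariskiTopology.
Variables (k : fieldType) (n : nat) (I : idealr {mpoly k[n]}).
Context {I_art : artinian_monomial I}.
Local Notation A := (monomial_algebra I).

(** Two automorphisms agree when their coordinates on the monomials do. *)
Lemma zariski_closed_equalizer (phi psi : alg_aut A -> alg_aut A) :
  regular_coefs phi -> regular_coefs psi ->
  zariski_closed [set g | phi g = psi g].
Proof.
move=> phiR psiR.
have -> : [set g | phi g = psi g] = [set g | forall bc : 'X_{1..n} * 'X_{1..n},
    cf bc.2 (phi g (mon I bc.1)) + (-1) * cf bc.2 (psi g (mon I bc.1)) = 0].
  apply/seteqP; split=> g /= => [-> bc|e]; first by rewrite mulN1r subrr.
  apply: aut_ext; apply: linear_mon_ext; try exact: linearP.
  move=> b; apply: eq_cf => c _; have /eqP := e (b, c).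
  by rewrite mulN1r subr_eq0 => /eqP.
apply: (zariski_closed_zeros (f := fun (bc : 'X_{1..n} * 'X_{1..n}) g =>
  cf bc.2 (phi g (mon I bc.1)) + (-1) * cf bc.2 (psi g (mon I bc.1)))) => bc.
apply: regular_add; first exact: phiR.
exact/regular_scale/psiR.
Qed.

Let coefs_id : regular_coefs (@id (alg_aut A)).
Proof. by move=> l v; apply: regular_coef. Qed.

Lemma raises1_closed : closed_subgroup (@raises k n I 1).
Proof.
split; first exact: raises_subgroup.
have -> : raises 1 = [set g : alg_aut A | linear_part g = 1%g].
  by apply/seteqP; split=> g /raises1_linear_part.
apply: (zariski_closed_equalizer (psi := fun=> 1%g)).
  exact: regular_coefs_linear_part.
by move=> l v; apply: regular_const.
Qed.

(** The substitutions of linear forms for the variables. *)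
Definition graded_auts : set (alg_aut A) := [set g | linear_part g = g].

Lemma graded_auts_closed : closed_subgroup graded_auts.
Proof.
split; last exact/zariski_closed_equalizer/coefs_id/regular_coefs_linear_part.
split=> [|g h]; first exact: linear_part1.
by rewrite /graded_auts /= linear_partM linear_partV => -> ->.
Qed.

End ZariskiTopology.

Section Connectedness.
Variables (k : closedFieldType) (n : nat) (I : idealr {mpoly k[n]}).
Context {I_art : artinian_monomial I}.
Local Notation A := (monomial_algebra I).
Local Notation mon := (mon I).
Local Notation basis := (basis I).

(** Conjugation by the homothety of ratio [t] multiplies the component of
    degree [d] of [g - 1] by [t ^+ d]; the resulting family extends to [t = 0],
    where it takes the value 1. *)
Lemma raises1_connected : zariski_connected (@raises k n I 1).
Proof.
have homothety t : exists g : alg_aut A,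
    t != 0 -> forall b, g (mon b) = t ^+ mdeg b *: mon b.
  have [->|t0] := eqVneq t 0; first by exists 1%g.
  have [g gE] := @torus_element _ _ I I_art (fun=> t) (fun=> t0).
  by exists g => _ b; rewrite gE prodrXr mdegE.
have [lam lamE] := choice homothety.
pose c (g : alg_aut A) t : alg_aut A := if t == 0 then 1%g else (lam t * g * (lam t)^-1)%g.
have cV g t : (c g t)^-1%g = c (g^-1)%g t.
  by rewrite /c; case: ifP => _; rewrite ?invg1 // !invgM invgK mulgA.
have craises g t : raises 1 g -> raises 1 (c g t).
  move=> /raises1_linear_part g1; apply/raises1_linear_part; rewrite /c.
  case: ifP => _; first exact: linear_part1.
  by rewrite !linear_partM g1 linear_partV mulg1 mulgV.
(* At [t = 0], and for [mdeg b' >= mdeg b], the power [0 ^+ (mdeg b' - mdeg b)]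
   singles out the component of degree [mdeg b], on which [g] acts as 1. *)
have cmon g t b : raises 1 g -> c g t (mon b) =
    \sum_(b' <- basis) (cf b' (g (mon b)) * t ^+ (mdeg b' - mdeg b)) *: mon b'.
  move=> g1; have gb : order_ge (mdeg b) (g (mon b)) by apply/aut_order_ge/order_ge_mon.
  rewrite /c; case: eqVneq => [->|t0].
    rewrite /= -{1}(raises1_gr b g1) [LHS]basis_expansion; apply: eq_bigr => b' _; congr (_ *: _).
    rewrite cf_gr expr0n subn_eq0; case: ltngtP => [/gb->|_|_].
    - by rewrite mul0r.
    - by rewrite mulr0.
    by rewrite mulr1.
  have lamV : (lam t)^-1%g (mon b) = (t ^+ mdeg b)^-1 *: mon b.
    apply: (can_inj (aut_mulK (lam t))).
    by rewrite aut_mulKV linearZ /= lamE // scalerA mulVf ?scale1r // expf_neq0.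
  rewrite !aut_mulE lamV !linearZ /= [g (mon b) in LHS]basis_expansion.
  rewrite linear_sum scaler_sumr; apply: eq_bigr => b' _.
  rewrite linearZ /= lamE // !scalerA; congr (_ *: _).
  have [b'b|bb'] := ltnP (mdeg b') (mdeg b); first by rewrite gb // mulr0 !mul0r.
  rewrite -mulrA mulrCA; congr (_ * _).
  by rewrite -{1}(subnK bb') exprD mulrCA mulVf ?mulr1 // expf_neq0.
apply: zariski_connected_by_lines => g g1; exists (c g); split.
- by move=> t; apply: craises.
- by rewrite /c eqxx.
- rewrite /c oner_eq0; have -> : lam 1 = 1%g; last by rewrite invg1 mulg1 mul1g.
  apply: aut_ext; apply: linear_mon_ext; try exact: linearP.
  by move=> b; rewrite lamE ?oner_eq0 // expr1n scale1r.
have poly_coef h (l : {scalar A}) v : raises 1 h -> exists p : {poly k},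
    forall t, l (c h t v) = p.[t].
  move=> h1.
  exists (\sum_(b <- basis) cf b v *: \sum_(b' <- basis)
    (cf b' (h (mon b)) * l (mon b')) *: 'X^(mdeg b' - mdeg b)) => t.
  rewrite {1}[v]basis_expansion !linear_sum horner_sum; apply: eq_bigr => b _.
  rewrite !linearZ hornerZ /= cmon // linear_sum horner_sum; congr (_ * _).
  apply: eq_bigr => b' _.
  by rewrite linearZ hornerZ hornerXn /= mulrAC.
move=> f; elim=> [l v|l v|a|f1 f2 _ [p1 E1] _ [p2 E2]|f1 f2 _ [p1 E1] _ [p2 E2]].
- exact: poly_coef.
- have [p pE] := poly_coef _ l v (is_subgroupV (raises_subgroup 1) g1).
  by exists p => t; rewrite cV pE.
- by exists a%:P => t; rewrite hornerC.
- by exists (p1 + p2) => t; rewrite hornerD E1 E2.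
by exists (p1 * p2) => t; rewrite hornerM E1 E2.
Qed.

End Connectedness.

(** * Homogeneous derivations *)

Section Lattice.
Variables (k : fieldType) (n : nat).
Implicit Types (b c : 'X_{1..n}) (z a : 'rV[int]_n).

Lemma mnm_vecD : {morph @mnm_vec n : b c / (b + c)%MM >-> b + c}.
Proof. by move=> b c; apply/rowP => i; rewrite !mxE mnmDE PoszD. Qed.

Lemma mnm_vec1 (i : 'I_n) : mnm_vec U_(i) = delta_mx 0 i.
Proof. by apply/rowP => j; rewrite !mxE mnm1E eqxx eq_sym; case: eqP. Qed.

Lemma nonnegP z : reflect (forall i, 0 <= z 0 i) (nonneg z).
Proof. exact: forallP. Qed.

Lemma nonneg_mnm_vec b : nonneg (mnm_vec b).
Proof. by apply/nonnegP => i; rewrite mxE. Qed.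

Lemma nonnegD z a : nonneg z -> nonneg a -> nonneg (z + a).
Proof. by move=> /nonnegP z0 /nonnegP a0; apply/nonnegP => i; rewrite mxE addr_ge0. Qed.

Lemma vec_mnmK z : nonneg z -> mnm_vec (vec_mnm z) = z.
Proof. by move=> /nonnegP z0; apply/rowP => i; rewrite mxE mnmE gez0_abs. Qed.

Lemma mnm_vecK : cancel (@mnm_vec n) (@vec_mnm n).
Proof. by move=> b; apply/mnmP => i; rewrite mnmE mxE. Qed.

Lemma mnm_vec_inj : injective (@mnm_vec n). Proof. exact: can_inj mnm_vecK. Qed.

Lemma coord_sumD : {morph @coord_sum n : z a / z + a}.
Proof. by move=> z a; rewrite /coord_sum -big_split; apply: eq_bigr => i _; rewrite mxE. Qed.

Lemma coord_sum_mnm_vec b : coord_sum (mnm_vec b) = (mdeg b)%:Z.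
Proof.
rewrite /coord_sum mdegE (big_morph Posz PoszD (erefl 0%:Z)).
by apply: eq_bigr => i _; rewrite mxE.
Qed.

Lemma pairingD (p : 'rV[k]_n) : {morph pairing p : z a / z + a}.
Proof.
move=> z a; rewrite /pairing -big_split; apply: eq_bigr => i _ /=.
by rewrite mxE rmorphD mulrDr.
Qed.

Lemma pairing1 (p : 'rV[k]_n) i : pairing p (mnm_vec U_(i)) = p 0 i.
Proof.
rewrite /pairing (bigD1 i) //= big1 ?addr0 => [|j ji].
  by rewrite mxE mnm1E eqxx mulr1.
by rewrite mxE mnm1E eq_sym (negbTE ji) mulr0.
Qed.

Lemma pairing0 (p : 'rV[k]_n) : pairing p 0 = 0.
Proof. by rewrite /pairing big1 // => i _; rewrite mxE mulr0. Qed.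

Lemma pairingZ (t : k) (p : 'rV[k]_n) z : pairing (t *: p) z = t * pairing p z.
Proof. by rewrite /pairing mulr_sumr; apply: eq_bigr => i _; rewrite mxE mulrA. Qed.

End Lattice.

Section HomogeneousDerivations.
Variables (k : fieldType) (n : nat) (I : idealr {mpoly k[n]}).
Context {I_art : artinian_monomial I}.
Local Notation A := (monomial_algebra I).
Local Notation mon := (mon I).
Local Notation basis := (basis I).
Implicit Types (b c : 'X_{1..n}) (u v : A) (z a : 'rV[int]_n).

(** The Laurent monomial of exponent [z], read in [A]. *)
Definition rpow z : A := residue I (xpow k z).

Lemma rpow_nonneg z : nonneg z -> rpow z = mon (vec_mnm z).
Proof. by rewrite /rpow /xpow => ->. Qed.

Lemma rpow_not_nonneg z : ~~ nonneg z -> rpow z = 0.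
Proof. by rewrite /rpow /xpow => /negbTE ->; rewrite linear0. Qed.

Lemma rpow_mnm_vec b : rpow (mnm_vec b) = mon b.
Proof. by rewrite rpow_nonneg ?mnm_vecK // nonneg_mnm_vec. Qed.

Lemma rpow_neq0 z : rpow z <> 0 -> nonneg z /\ vec_mnm z \in basis.
Proof.
have [z0 rz|z0 []] := boolP (nonneg z); last exact: rpow_not_nonneg.
split=> //; apply: contrapT => /negP zB; apply: rz.
by rewrite rpow_nonneg // mon_notin_basis.
Qed.

Lemma rpowD z a : nonneg z -> nonneg a -> rpow (z + a) = rpow z * rpow a.
Proof.
move=> z0 a0; rewrite !rpow_nonneg ?nonnegD // -monD; congr (mon _).
by apply: mnm_vec_inj; rewrite mnm_vecD !vec_mnmK ?nonnegD.
Qed.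

Lemma gr_rpow d z : coord_sum z = d%:Z -> gr d (rpow z) = rpow z.
Proof.
move=> zd; have [z0|z0] := boolP (nonneg z); last by rewrite rpow_not_nonneg ?linear0.
have [dE] : (mdeg (vec_mnm z))%:Z = d%:Z by rewrite -coord_sum_mnm_vec vec_mnmK.
by rewrite rpow_nonneg // gr_mon dE eqxx.
Qed.

Lemma proj_rpow z u : exists c : k, proj (@mnm_vec n) z u = c *: rpow z.
Proof.
have [z0|z0] := boolP (nonneg z); last first.
  exists 0; rewrite scale0r; apply: eq_cf => b _; rewrite cf_proj linear0.
  by case: eqP => // bz; rewrite -bz nonneg_mnm_vec in z0.
exists (cf (vec_mnm z) u); rewrite rpow_nonneg //; apply: eq_cf => b bB.
rewrite cf_proj linearZ /= cf_mon -(inj_eq (@mnm_vec_inj n)) vec_mnmK //.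
case: eqP => [bz|_]; last by rewrite mulr0.
by rewrite -bz mnm_vecK bB mulr1.
Qed.

Lemma component_homogeneous a (D : A -> A) : D 0 = 0 ->
  homogeneous_of_degree I a (component (@mnm_vec n) a D).
Proof. by move=> D0 b; rewrite component_mon //; apply: proj_rpow. Qed.

(** Away from the exponents allowed in [k[x]] the coefficient [p(b)] has to
    vanish, so the truncation of Laurent monomials is compatible with the
    Leibniz rule. *)
Lemma homogeneous_derivation_mon a (D : A -> A) :
  is_derivation D -> homogeneous_of_degree I a D ->
  exists p : 'rV[k]_n, (forall i, p 0 i != 0 -> D (mon U_(i)) <> 0) /\
    (forall b, D (mon b) = pairing p (mnm_vec b) *: rpow (mnm_vec b + a)).
Proof.
move=> [Dlin leibniz] Dhom.
have /choice[q qP] i : exists c : k, (c != 0 -> D (mon U_(i)) <> 0) /\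
    D (mon U_(i)) = c *: rpow (mnm_vec U_(i) + a).
  have [D0|D0] := pselect (D (mon U_(i)) = 0).
    by exists 0; rewrite eqxx scale0r.
  by have [c cE] := Dhom U_(i)%MM; exists c.
pose p : 'rV[k]_n := \row_i q i.
have p_neq0 i : p 0 i != 0 -> D (mon U_(i)) <> 0 by rewrite mxE => /(qP i).1.
have DU i : D (mon U_(i)) = p 0 i *: rpow (mnm_vec U_(i) + a) by rewrite mxE (qP i).2.
have p_nonneg i : p 0 i != 0 -> nonneg (mnm_vec U_(i) + a).
  move=> /p_neq0; rewrite DU => D0; apply: contrapT => /negP na; apply: D0.
  by rewrite rpow_not_nonneg ?scaler0.
have pb_nonneg b : pairing p (mnm_vec b) != 0 -> nonneg (mnm_vec b + a).
  elim/multinom_ind: b => [|i b IH].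
    have -> : mnm_vec 0%MM = 0 :> 'rV_n by apply/rowP => i; rewrite !mxE mnm0E.
    by rewrite pairing0 eqxx.
  rewrite mnm_vecD pairingD pairing1.
  have [->|/p_nonneg ia _] := eqVneq (p 0 i) 0; last first.
    by rewrite addrAC; apply/nonnegD/nonneg_mnm_vec.
  by rewrite add0r => /IH ba; rewrite -addrA; apply/nonnegD/ba/nonneg_mnm_vec.
exists p; split=> // b; elim/multinom_ind: b => [|i b IH].
  have -> : mnm_vec 0%MM = 0 :> 'rV_n by apply/rowP => i; rewrite !mxE mnm0E.
  by rewrite pairing0 scale0r mon0 derivation1.
rewrite monD leibniz IH DU mnm_vecD pairingD pairing1 scalerDl; congr (_ + _).
  have [->|/p_nonneg ia] := eqVneq (p 0 i) 0; first by rewrite !scale0r mul0r.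
  by rewrite -scalerAl [in RHS]addrAC [in RHS]rpowD ?nonneg_mnm_vec // rpow_mnm_vec.
have [->|/pb_nonneg ba] := eqVneq (pairing p (mnm_vec b)) 0.
  by rewrite !scale0r mulr0.
by rewrite -scalerAr -addrA [in RHS]rpowD ?nonneg_mnm_vec // rpow_mnm_vec.
Qed.

Lemma derivation_neq0 (D : A -> A) : is_derivation D -> (exists u, D u <> 0) ->
  exists i, D (mon U_(i)) <> 0.
Proof.
move=> [Dlin leibniz] [u Du]; apply: contrapT => noi; apply: Du.
have D0 i : D (mon U_(i)) = 0 by apply: contrapT => Di; apply: noi; exists i.
move: u; apply: linear_mon_eq0 => // b.
elim/multinom_ind: b => [|i b IH]; first by rewrite mon0 derivation1.
by rewrite monD leibniz IH D0 mul0r mulr0 addr0.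
Qed.

(** A linear map given on monomials by the formula for [hom_deriv a p] kills
    the relations of [A], so representatives do not matter. *)
Lemma hom_deriv_quotE a p (L : A -> A) : linear L ->
  (forall b, L (mon b) = pairing p (mnm_vec b) *: rpow (mnm_vec b + a)) ->
  hom_deriv_quot I a p = L.
Proof.
move=> Llin LE; apply: funext => u; rewrite /hom_deriv_quot /hom_deriv.
have -> : L u = linear_fun Llin (\sum_(b <- msupp (repr u)%qT) (repr u)%qT@_b *: mon b).
  by rewrite -residueE reprK_residue.
rewrite !linear_sum; apply: eq_bigr => b _.
by rewrite linearZ [RHS]linearZ /= LE scalerA.
Qed.

(** The exponents [e_i + a] have to be nonnegative for [x_i] to have a nonzero
    image: a negative coordinate of [a] is thus -1, at the index [i]. *)
Lemma outer_root_coordinate a (i j : 'I_n) :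
  rpow (mnm_vec U_(i) + a) <> 0 -> a 0 j < 0 -> j = i /\ a 0 j = -1.
Proof.
move=> /rpow_neq0[/nonnegP/(_ j)]; rewrite mxE mxE mnm1E.
case: (i =P j) => [-> a1 _ a0|_ + _ a0]; last by rewrite add0r leNgt a0.
split=> //; move: (a 0 j) a1 a0 => x /=; lia.
Qed.

(** The functional [p] is read off the images of the variables. *)
Lemma homogeneous_derivation_hom_deriv a (D : A -> A) :
  is_derivation D -> homogeneous_of_degree I a D -> (exists u, D u <> 0) ->
  exists p, [/\ N_space I a p, p <> 0 & D = hom_deriv_quot I a p].
Proof.
move=> Dder Dhom Dneq0; have [p [pP DE]] := homogeneous_derivation_mon Dder Dhom.
have [j Dj] := derivation_neq0 Dder Dneq0.
have rpow_i i : D (mon U_(i)) <> 0 -> rpow (mnm_vec U_(i) + a) <> 0.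
  by rewrite DE => + r0; rewrite r0 scaler0.
exists p; split.
- rewrite /N_space; case: ifPn => [a0 i /eqP/pP/rpow_i|].
    rewrite mnm_vec1 addrC => /rpow_neq0[a1]; rewrite mem_basis => /negP.
    by split.
  rewrite negb_forall => /existsP[l]; rewrite -ltNge => al.
  have [_ al1] := outer_root_coordinate (rpow_i _ Dj) al.
  exists l, (p 0 l); split=> //; apply/rowP => i; rewrite !mxE eqxx /=.
  have [->|il] := eqVneq i l; first by rewrite mulr1.
  rewrite mulr0; apply: contrapT => /eqP/pP/rpow_i/outer_root_coordinate/(_ al)[].
  by move/esym/eqP; rewrite (negbTE il).
- by move=> p0; apply: Dj; rewrite DE pairing1 p0 mxE scale0r.
by apply/esym/hom_deriv_quotE; [exact: Dder.1|exact: DE].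
Qed.

(** For an outer degree the line [N_space I a] is spanned by the functional of
    the derivation that makes [a] a root. *)
Lemma hom_deriv_quot_homogeneous a p : is_root I a -> N_space I a p ->
  linear (hom_deriv_quot I a p) /\ homogeneous_of_degree I a (hom_deriv_quot I a p).
Proof.
move=> [a_neq0 [D [Dder Dhom Dneq0]]] Np.
suff [L [Llin LE]] : exists L : A -> A, linear L /\
    forall b, L (mon b) = pairing p (mnm_vec b) *: rpow (mnm_vec b + a).
  rewrite (hom_deriv_quotE Llin LE); split=> // b.
  by exists (pairing p (mnm_vec b)); apply: LE.
move: Np; rewrite /N_space; case: ifPn => [a0 _|_ [l [c [al ->]]]].
  pose F b := pairing p (mnm_vec b) *: rpow (mnm_vec b + a).
  exists (fun u => \sum_(b <- basis) cf b u *: F b); split; first exact: linear_sum_cf.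
  move=> b; have [bB|bB] := boolP (b \in basis); first by rewrite sum_cf_mon.
  rewrite rpowD ?nonneg_mnm_vec // rpow_mnm_vec mon_notin_basis // mul0r scaler0.
  by rewrite big1 // => b' _; rewrite linear0 scale0r.
have [q [qP DE]] := homogeneous_derivation_mon Dder Dhom.
have [j Dj] := derivation_neq0 Dder Dneq0.
have rpow_i i : D (mon U_(i)) <> 0 -> rpow (mnm_vec U_(i) + a) <> 0.
  by rewrite DE => + r0; rewrite r0 scaler0.
have al0 : a 0 l < 0 by rewrite al.
have [lj _] := outer_root_coordinate (rpow_i _ Dj) al0.
have ql : q 0 l != 0.
  by apply/eqP => q0; apply: Dj; rewrite DE pairing1 -lj q0 scale0r.
have qE : q = q 0 l *: delta_mx 0 l.
  apply/rowP => i; rewrite !mxE eqxx /=.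
  have [->|il] := eqVneq i l; first by rewrite mulr1.
  rewrite mulr0; apply: contrapT => /eqP/qP/rpow_i/outer_root_coordinate/(_ al0)[].
  by move/esym/eqP; rewrite (negbTE il).
exists (fun u => (c / q 0 l) *: D u); split=> [d x y|b].
  by rewrite Dder.1 scalerDr !scalerA mulrC.
by rewrite DE scalerA [q in pairing q]qE !pairingZ mulrA divfK.
Qed.

Lemma homogeneous_rpow a (D : A -> A) z : linear D -> homogeneous_of_degree I a D ->
  exists c : k, D (rpow z) = c *: rpow (z + a).
Proof.
move=> Dlin Dhom; have [z0|z0] := boolP (nonneg z).
  by have [c cE] := Dhom (vec_mnm z); exists c; rewrite rpow_nonneg // [LHS]cE vec_mnmK.
exists 0; rewrite rpow_not_nonneg // scale0r.
exact: linear_at0.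
Qed.

(** The exponents of the basis lie in a bounded box, which they leave after
    enough translations by the nonzero vector [a]. *)
Lemma homogeneous_nilpotent a (D : A -> A) : linear D -> homogeneous_of_degree I a D ->
  a <> 0 -> exists N, forall x, iter N D x = 0.
Proof.
move=> Dlin Dhom a0.
have [i ai] : exists i, a 0 i != 0.
  apply: contrapT => noi; apply: a0; apply/rowP => i; rewrite mxE.
  by apply/eqP/contraT => ai; case: noi; exists i.
pose K := \max_(b <- basis) mdeg b.
have basisK b : b \in basis -> (b i <= K)%N.
  move=> bB; apply: (@leq_trans (mdeg b)); first by rewrite mdegE (bigD1 i) ?leq_addr.
  by rewrite /K (bigD1_seq b) ?basis_uniq //= leq_maxl.
exists K.+1.
have iter_lin N : linear (iter N D).
  by elim: N => //= N IH c x y; rewrite !iterS IH Dlin.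
apply: linear_mon_eq0 => // b.
have [bB|bB] := boolP (b \in basis); last first.
  by rewrite mon_notin_basis // linear_at0.
have [c ->] : exists c : k, iter K.+1 D (mon b) = c *: rpow (mnm_vec b + a *+ K.+1).
  elim: (K.+1) => [|N [c IH]]; first by exists 1; rewrite scale1r addr0 rpow_mnm_vec.
  have [c' c'E] := homogeneous_rpow (mnm_vec b + a *+ N) Dlin Dhom.
  exists (c * c'); rewrite iterS IH -[LHS]/(linear_fun Dlin _) linearZ /=.
  by rewrite c'E scalerA mulrSr addrA.
apply: contrapT => r0; have /rpow_neq0[z0 zB] : rpow (mnm_vec b + a *+ K.+1) <> 0.
  by move=> r; apply: r0; rewrite r scaler0.
have := congr1 (fun z : 'rV_n => z 0 i) (vec_mnmK z0).
rewrite !mxE mulmxnE -mulr_natr natz.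
move: (basisK _ zB) (basisK _ bB) ai.
move: (vec_mnm _ i) (b i) (a 0 i) => v w x vK wK x0.
nia.
Qed.

End HomogeneousDerivations.

(** * Root subgroups and the generation of the kernel *)

Section RootSubgroups.
Variables (k : fieldType) (n : nat) (I : idealr {mpoly k[n]}).
Context {I_art : artinian_monomial I}.
Hypothesis char0 : [pchar k] =i pred0.
Local Notation A := (monomial_algebra I).
Local Notation mon := (mon I).
Local Notation basis := (basis I).
Implicit Types (b c : 'X_{1..n}) (u v : A) (z a : 'rV[int]_n) (d e : nat).

Lemma root_exponential a (D : A -> A) : a <> 0 -> is_derivation D ->
  homogeneous_of_degree I a D -> (exists u, D u <> 0) ->
  exists p g, [/\ is_root I a, N_space I a p, p <> 0, root_subgroup I a p g &
    is_exp D g].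
Proof.
move=> a0 Dder Dhom Dneq0.
have [p [Np p0 DE]] := homogeneous_derivation_hom_deriv Dder Dhom Dneq0.
have [N nilD] := homogeneous_nilpotent Dder.1 Dhom a0.
have [g gexp] := @exponential_exists k A char0 (linear_fun Dder.1) N Dder.2 nilD.
exists p, g; split=> //; first by split=> //; exists D.
move=> H [_ HS]; apply: HS; exists 1.
by have -> : (fun u => 1 *: hom_deriv_quot I a p u) = D
  by rewrite -DE; apply: funext => u; rewrite scale1r.
Qed.

(** The criterion by which root subgroups are placed inside closed subgroups. *)
Lemma root_subgroup_min a p (H : set (alg_aut A)) : is_root I a -> N_space I a p ->
  closed_subgroup H ->
  (forall D g, linear D -> homogeneous_of_degree I a D -> is_exp D g -> H g) ->
  root_subgroup I a p `<=` H.
Proof.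
move=> aroot Np Hclosed Hexp g; apply; split=> // {}g [t].
have [Dlin Dhom] := hom_deriv_quot_homogeneous aroot Np.
apply: Hexp => [c x y|b].
  by rewrite Dlin scalerDr !scalerA mulrC.
by have [c cE] := Dhom b; exists (t * c); rewrite cE scalerA.
Qed.

Definition shifts d (D : A -> A) : Prop :=
  forall e u, order_ge e u -> order_ge (e + d) (D u).

Lemma homogeneous_gr a d e (D : A -> A) u : linear D -> homogeneous_of_degree I a D ->
  coord_sum a = d%:Z -> D (gr e u) = gr (e + d) (D u).
Proof.
move=> Dlin Dhom ad; move: u.
apply: (linear_mon_ext (f := fun u => D (gr e u)) (g := fun u => gr (e + d) (D u))).
- by move=> c x y; rewrite linearP Dlin.
- by move=> c x y; rewrite Dlin linearP.
move=> b; have [c cE] : exists c : k, D (mon b) = c *: rpow I (mnm_vec b + a) := Dhom b.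
have rE : gr (mdeg b + d) (rpow I (mnm_vec b + a)) = rpow I (mnm_vec b + a).
  by apply: gr_rpow; rewrite coord_sumD coord_sum_mnm_vec ad.
rewrite gr_mon cE linearZ /=; case: eqP => [<-|/eqP be]; first by rewrite rE cE.
rewrite (linear_at0 Dlin) -rE; apply: eq_cf => b' _.
rewrite linear0 linearZ /= !cf_gr.
by case: eqP => [->|_]; rewrite ?mulr0 // eqn_add2r eq_sym (negbTE be) mulr0.
Qed.

Lemma homogeneous_shifts a d (D : A -> A) : linear D -> homogeneous_of_degree I a D ->
  coord_sum a = d%:Z -> shifts d D.
Proof.
move=> Dlin Dhom ad e; apply: order_ge_ind => [|c x y|b eb].
- by rewrite (linear_at0 Dlin); apply: order_ge0.
- by rewrite Dlin; apply: order_ge_comb.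
apply: (@order_geW _ _ _ _ (mdeg b + d)); first by rewrite leq_add2r.
have := homogeneous_gr (mdeg b) (mon b) Dlin Dhom ad.
by rewrite gr_mon eqxx => ->; apply: order_ge_gr.
Qed.

(** The bound is the same as in [is_exp] once the first two terms are split off,
    because the terms of index at least [N] vanish. *)
Lemma exp_two_terms (D : A -> A) g : linear D -> is_exp D g ->
  exists N, forall u, g u = u + D u + \sum_(i < N) (i.+2`!%:R)^-1 *: iter i.+2 D u.
Proof.
move=> Dlin [N nilD gE]; exists N => u.
have nilD_ge i : (N <= i)%N -> iter i D u = 0.
  by move=> /subnK <-; rewrite addnC iterD nilD.
have -> : g u = \sum_(i < N.+2) (i`!%:R)^-1 *: iter i D u.
  by rewrite gE !big_ord_recr /= nilD_ge // (linear_at0 Dlin) !scaler0 !addr0.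
by rewrite !big_ord_recl /= !invr1 !scale1r addrA.
Qed.

Lemma exp_shifts d (D : A -> A) g : linear D -> shifts d D -> is_exp D g ->
  forall e u, order_ge e u -> order_ge (e + d + d) (g u - u - D u).
Proof.
move=> Dlin Dd /(exp_two_terms Dlin)[N gE] e u ue.
rewrite gE [_ + \sum_(i < N) _]addrC -[_ - u - _]addrA -opprD addrK.
apply: order_ge_sum => i _; apply: order_geZ; rewrite 2!iterSr.
elim: (i : nat) => [|m IH]; first by apply/Dd/Dd.
by rewrite iterS; apply: order_geW (Dd _ _ IH); apply: leq_addr.
Qed.

Lemma exp_raises d (D : A -> A) g : linear D -> shifts d D -> is_exp D g -> raises d g.
Proof.
move=> Dlin Dd gexp e u ue; rewrite -[g u - u](subrK (D u)).
apply: order_geD; last exact: Dd.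
by apply: order_geW (exp_shifts Dlin Dd gexp ue); apply: leq_addr.
Qed.

Lemma exp_leading d a (D : A -> A) g : linear D -> homogeneous_of_degree I a D ->
  coord_sum a = d.+1%:Z -> is_exp D g -> leading d.+1 g =1 D.
Proof.
move=> Dlin Dhom ad gexp; have Dd := homogeneous_shifts Dlin Dhom ad.
apply: linear_mon_ext => // [|b]; first exact: leading_linear.
rewrite leading_mon -[g _ - _](subrK (D (mon b))) linearD /=.
have b_ord : order_ge (mdeg b) (mon b) by apply: order_ge_mon.
rewrite (order_ge_gr_eq0 _ (exp_shifts Dlin Dd gexp b_ord)); last first.
  by rewrite -[X in (X < _)%N]addn0 ltn_add2l.
by rewrite add0r -(homogeneous_gr _ _ Dlin Dhom ad) gr_mon eqxx.
Qed.

Lemma exp_graded a (D : A -> A) g : linear D -> homogeneous_of_degree I a D ->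
  coord_sum a = 0 -> is_exp D g -> linear_part g = g.
Proof.
move=> Dlin Dhom a0 [N _ gE]; apply: aut_ext.
apply: linear_mon_ext; try exact: linearP.
move=> b; rewrite linear_part_mon gE linear_sum; apply: eq_bigr => i _.
rewrite linearZ; congr (_ *: _) => /=.
elim: (i : nat) => [|m IH] /=; first by rewrite gr_mon eqxx.
by rewrite -{1}[mdeg b]addn0 -(homogeneous_gr _ _ Dlin Dhom a0) IH.
Qed.

Lemma positive_root_subgroup_raises : positive_root_subgroups I `<=` raises 1.
Proof.
move=> g [a [p [aroot a_gt0 Np]]]; apply: root_subgroup_min g => //.
  exact: raises1_closed.
move=> D g Dlin Dhom gexp.
have [d ad] : exists d, coord_sum a = d.+1%:Z.
  by case: (coord_sum a) a_gt0 => [[|d]|]// _; exists d.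
by apply: raisesW (exp_raises Dlin (homogeneous_shifts Dlin Dhom ad) gexp).
Qed.

Lemma neutral_root_subgroup_graded a p : is_root I a -> coord_sum a = 0 ->
  N_space I a p -> root_subgroup I a p `<=` graded_auts (I := I).
Proof.
move=> aroot a0 Np; apply: root_subgroup_min => //.
  exact: graded_auts_closed.
by move=> D g Dlin Dhom; apply: exp_graded.
Qed.

Local Notation P := (subgroup_generated (positive_root_subgroups I)).

Lemma leading1 d u : leading d (1 : alg_aut A)%g u = 0.
Proof.
move: u; apply: linear_mon_eq0 => [|b]; first exact: leading_linear.
by rewrite leading_mon subrr linear0.
Qed.

(** The component is zero or a root derivation, whose exponential has it as its
    leading term. *)
Lemma leading_component_exp d g a : raises d.+1 g ->
  exists w, [/\ P w, raises d.+1 w &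
    leading d.+1 w =1 component (@mnm_vec n) a (leading d.+1 g)].
Proof.
move=> gd; set D := component _ _ _.
have Lder : is_derivation (leading d.+1 g) by exact: leading_derivation.
have L0 : leading d.+1 g 0 = 0 by rewrite /leading linear0.
have Dder : is_derivation D by apply: component_derivation; [exact: mnm_vecD|exact: Lder].
have Dhom : homogeneous_of_degree I a D by exact: component_homogeneous.
have [Dneq0|D0] := pselect (exists u, D u <> 0); last first.
  have {}D0 u : D u = 0 by apply: contrapT => Du; apply: D0; exists u.
  exists 1%g; split; first exact: (subgroup_generated_is_subgroup _).1.
    exact: (raises_subgroup _).1.
  by move=> u; rewrite D0 leading1.
have ad : coord_sum a = d.+1%:Z.
  have [i Di] := derivation_neq0 Dder Dneq0.
  apply: contrapT => ad; apply: Di; rewrite /D component_mon //.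
  apply: eq_cf => c _; rewrite cf_proj linear0; case: eqP => // cE.
  rewrite leading_mon cf_gr; case: eqP => // cd; case: ad.
  apply: (addrI (mdeg U_(i))%:Z); rewrite -[in LHS]coord_sum_mnm_vec.
  by rewrite -coord_sumD -cE coord_sum_mnm_vec cd PoszD.
have a0 : a <> 0.
  by move=> a0; move: ad; rewrite a0 /coord_sum big1 // => i _; rewrite mxE.
have [p [w [aroot Np _ wU wexp]]] := root_exponential a0 Dder Dhom Dneq0.
exists w; split.
- by move=> H [_]; apply; exists a, p; split=> //; rewrite ad.
- exact: exp_raises Dder.1 (homogeneous_shifts Dder.1 Dhom ad) wexp.
exact: exp_leading Dder.1 Dhom ad wexp.
Qed.

Lemma leading_exp d g : raises d.+1 g ->
  exists w, [/\ P w, raises d.+1 w & leading d.+1 w =1 leading d.+1 g].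
Proof.
move=> gd; pose s := undup [seq mnm_vec c - mnm_vec b | b <- basis, c <- basis].
have sE : forall u, leading d.+1 g u =
    \sum_(a <- s) component (@mnm_vec n) a (leading d.+1 g) u.
  apply: sum_component; rewrite ?undup_uniq //; first exact: leading_linear.
  by move=> b c bB cB; rewrite mem_undup; apply/allpairsP; exists (b, c).
suff [w [Pw wd wE]] : exists w, [/\ P w, raises d.+1 w & forall u, leading d.+1 w u =
    \sum_(a <- s) component (@mnm_vec n) a (leading d.+1 g) u].
  by exists w; split=> // u; rewrite wE -sE.
elim: (s) => [|a t [w [Pw wd wE]]].
  exists 1%g; split; first exact: (subgroup_generated_is_subgroup _).1.
    exact: (raises_subgroup _).1.
  by move=> u; rewrite big_nil leading1.
have [wa [Pwa wad waE]] := leading_component_exp a gd.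
exists (wa * w)%g; split.
- exact: is_subgroupM (subgroup_generated_is_subgroup _) Pwa Pw.
- exact: is_subgroupM (raises_subgroup _) wad wd.
by move=> u; rewrite big_cons leadingM // waE wE.
Qed.

(** Successive approximation: an exponential with the same leading term as [g]
    divides [g] into the next step of the filtration, which ends at 1. *)
Lemma raises1_generated : raises 1 = P.
Proof.
apply/seteqP; split=> g; last first.
  move=> Pg; apply: Pg; split; first exact: raises_subgroup.
  exact: positive_root_subgroup_raises.
have [dtop top] := @raises_top _ _ I I_art.
suff main j d : (dtop <= j + d.+1)%N -> forall g, raises d.+1 g -> P g.
  by apply: (main dtop 0%N); apply: leq_addr.
have Psub := @subgroup_generated_is_subgroup _ (positive_root_subgroups I).
elim: j d => [|j IH] d le_top h hd.
  by rewrite (top h); [exact: Psub.1|exact: raisesW le_top hd].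
have [w [Pw wd wE]] := leading_exp hd.
rewrite -[h]mulg1 -(mulVg w) mulgA; apply: (is_subgroupM Psub _ Pw).
apply: (IH d.+1); first by rewrite addnS.
have wVd : raises d.+1 (w^-1)%g by exact: (is_subgroupV (raises_subgroup _) wd).
apply: raisesS; first exact: (is_subgroupM (raises_subgroup _) hd wVd).
move=> u; rewrite leadingM // -wE -leadingM // mulgV.
exact: leading1.
Qed.

End RootSubgroups.

(** * Graded automorphisms *)

Section GradedAutomorphisms.
Variables (k : fieldType) (n : nat) (I : idealr {mpoly k[n]}).
Context {I_art : artinian_monomial I}.
Hypothesis char0 : [pchar k] =i pred0.
Local Notation A := (monomial_algebra I).
Local Notation mon := (mon I).
Local Notation basis := (basis I).
Implicit Types (b c : 'X_{1..n}) (u v : A) (z a : 'rV[int]_n) (g h : alg_aut A).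
Implicit Types (i j l q : 'I_n).

Local Notation x i := (mon U_(i)%MM).

Lemma variable_basis i : U_(i)%MM \in basis.
Proof. by rewrite mem_basis artinian_variables. Qed.

Lemma cf_variable i j : cf U_(j)%MM (x i) = (j == i)%:R.
Proof. by rewrite cf_mon variable_basis andbT eq_mnm1. Qed.

Lemma variable_neq0 i : x i <> 0.
Proof. by move/mon_eq0; apply/negP/artinian_variables. Qed.

(** The variables are a basis of the component of degree 1, none of them being
    in [I]. *)
Lemma gr1_expansion u : gr 1 u = \sum_i cf U_(i)%MM u *: x i.
Proof.
apply: eq_cf => c _; rewrite cf_gr linear_sum.
have [/mdeg1P[j /eqP->]|c1] := boolP (mdeg c == 1%N).
  rewrite (bigD1 j) //= linearZ /= cf_variable eqxx mulr1 big1 ?addr0 // => i ij.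
  by rewrite linearZ /= cf_variable eq_sym (negbTE ij) mulr0.
rewrite big1 // => i _; rewrite linearZ /= cf_mon.
case: eqP => [ci|_]; last by rewrite mulr0.
by rewrite ci mdeg1 in c1.
Qed.

Lemma eq_aut_variables g h : (forall i, g (x i) = h (x i)) -> g = h.
Proof.
move=> gh; apply: aut_ext; apply: linear_mon_ext; try exact: linearP.
move=> b; elim/multinom_ind: b => [|i b IH]; first by rewrite mon0 !aut_one.
by rewrite monD !aut_mul gh IH.
Qed.

Lemma graded_variables g : (forall i, exists c : 'I_n -> k,
    g (x i) = \sum_j c j *: x j) -> graded_auts g.
Proof.
move=> gx; apply: eq_aut_variables => i; rewrite linear_part_mon mdeg1.
have [c ->] := gx i; rewrite linear_sum; apply: eq_bigr => j _.
by rewrite linearZ /= gr_mon mdeg1.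
Qed.

Definition coef_mx g : 'M[k]_n := \matrix_(i, j) cf U_(j)%MM (g (x i)).

Lemma coef_mxE g i : graded_auts g -> g (x i) = \sum_j coef_mx g i j *: x j.
Proof.
move=> gg; have : gr 1 (g (x i)) = g (x i).
  by rewrite -[in RHS]gg linear_part_mon mdeg1.
by rewrite gr1_expansion => {1}<-; apply: eq_bigr => j _; rewrite mxE.
Qed.

Lemma coef_mxVM g : graded_auts g -> coef_mx (g^-1)%g *m coef_mx g = 1%:M.
Proof.
move=> gg; have gV := is_subgroupV (graded_auts_closed (I := I)).1 gg.
apply/matrixP => i l; rewrite !mxE.
have <- : cf U_(l)%MM (g ((g^-1)%g (x i))) = (i == l)%:R.
  by rewrite aut_mulKV cf_variable eq_sym.
rewrite (coef_mxE i gV) !linear_sum; apply: eq_bigr => j _.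
by rewrite !linearZ /= !mxE.
Qed.

Definition euler i u : A := \sum_(b <- basis) cf b u *: ((b i)%:R *: mon b).

Lemma euler_linear i : linear (euler i). Proof. exact: linear_sum_cf. Qed.
HB.instance Definition _ i := GRing.isLinear.Build k A A *:%R (euler i) (euler_linear i).

Lemma euler_mon i b : euler i (mon b) = (b i)%:R *: mon b.
Proof.
have [bB|bB] := boolP (b \in basis).
  by rewrite /euler (sum_cf_mon (fun b => _ *: mon b)).
by rewrite mon_notin_basis // linear0 scaler0.
Qed.

Lemma euler_derivation i : is_derivation (euler i).
Proof.
apply: derivation_on_monomials => [|b c]; first exact: euler_linear.
rewrite -monD !euler_mon mnmDE natrD scalerDl monD.
by rewrite -scalerAl -scalerAr.
Qed.

Lemma conj_derivation g (D : A -> A) : is_derivation D ->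
  is_derivation (fun u => (g^-1)%g (D (g u))).
Proof.
move=> [Dlin leibniz]; split=> [c u v|u v]; first by rewrite linearP Dlin linearP.
by rewrite aut_mul leibniz linearD /= !aut_mul !aut_mulK.
Qed.

Lemma commutator_derivation (D D' : A -> A) : is_derivation D -> is_derivation D' ->
  is_derivation (fun u => D' (D u) - D (D' u)).
Proof.
move=> [Dlin leibniz] [Dlin' leibniz']; split=> [c u v|u v].
  by rewrite Dlin Dlin' Dlin' Dlin scalerBr opprD addrACA.
have addD y w : D (y + w) = D y + D w := linearD (linear_fun Dlin) y w.
have addD' y w : D' (y + w) = D' y + D' w := linearD (linear_fun Dlin') y w.
rewrite leibniz leibniz' addD addD' !leibniz !leibniz' mulrBl mulrBr.
rewrite [D' u * D v + _]addrC addrACA [D u * D' v + _ in X in _ - X]addrC.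
rewrite [X in _ - X]addrACA [D u * D' v + _]addrC.
by rewrite opprD addrACA subrr addr0 opprD addrACA.
Qed.

Lemma homogeneous_comp a a' (D D' : A -> A) : linear D' ->
  homogeneous_of_degree I a D -> homogeneous_of_degree I a' D' ->
  homogeneous_of_degree I (a + a') (fun u => D' (D u)).
Proof.
move=> Dlin Dhom Dhom' b; have [c ->] := Dhom b.
have [c' cE'] := homogeneous_rpow (mnm_vec b + a) Dlin Dhom'.
exists (c * c'); rewrite -[LHS]/(linear_fun Dlin _) linearZ /=.
by rewrite [D' _]cE' -addrA scalerA.
Qed.

Lemma homogeneous_sub a (D D' : A -> A) :
  homogeneous_of_degree I a D -> homogeneous_of_degree I a D' ->
  homogeneous_of_degree I a (fun u => D u - D' u).
Proof.
move=> Dhom Dhom' b; have [c ->] := Dhom b; have [c' ->] := Dhom' b.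
by exists (c - c'); rewrite scalerBl.
Qed.

(** For [l != q] this says that [e_q - e_l] is a root; the case [l = q] is
    allowed, with the Euler derivations as witnesses, to get a preorder. *)
Definition root_between l q : Prop := exists D : A -> A,
  [/\ is_derivation D,
      homogeneous_of_degree I (mnm_vec U_(q)%MM - mnm_vec U_(l)%MM) D &
      D (x l) <> 0].

Lemma root_between_refl l : root_between l l.
Proof.
exists (euler l); split; first exact: euler_derivation.
  by move=> b; exists (b l)%:R; rewrite subrr addr0 [LHS]euler_mon -rpow_mnm_vec.
by rewrite euler_mon mnm1E eqxx scale1r; apply: variable_neq0.
Qed.

Lemma homogeneous_variable_neq (D : A -> A) l q j :
  homogeneous_of_degree I (mnm_vec U_(q)%MM - mnm_vec U_(l)%MM) D ->
  l != q -> j != l -> D (x j) = 0.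
Proof.
move=> Dhom lq jl; have [c ->] := Dhom U_(j)%MM.
rewrite -/(rpow I _) rpow_not_nonneg ?scaler0 //.
apply/negP => /nonnegP/(_ l); rewrite !mxE !mnm1E eqxx (negbTE jl).
by rewrite [q == l]eq_sym (negbTE lq).
Qed.

Lemma homogeneous_variable (D : A -> A) l q :
  homogeneous_of_degree I (mnm_vec U_(q)%MM - mnm_vec U_(l)%MM) D ->
  exists c : k, D (x l) = c *: x q.
Proof.
move=> Dhom; have [c cE] := Dhom U_(l)%MM; exists c; rewrite [LHS]cE.
by rewrite addrC subrK -/(rpow I _) rpow_mnm_vec.
Qed.

(** Commutators of root derivations make the relation transitive. *)
Lemma root_between_trans q l j : root_between l q -> root_between q j -> root_between l j.
Proof.
have [->//|lq] := eqVneq l q; have [->//|qj] := eqVneq q j.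
have [-> _ _|lj] := eqVneq l j; first exact: root_between_refl.
move=> [D [Dder Dhom Dl]] [D' [Dder' Dhom' Dq]].
have [c cE] := homogeneous_variable Dhom.
have [c' cE'] := homogeneous_variable Dhom'.
exists (fun u => D' (D u) - D (D' u)); split; first exact: commutator_derivation.
  apply: homogeneous_sub.
    have := homogeneous_comp Dder'.1 Dhom Dhom'.
    by rewrite [_ - mnm_vec U_(l)%MM + _]addrC addrA subrK.
  have := homogeneous_comp Dder.1 Dhom' Dhom.
  by rewrite addrA subrK.
rewrite (homogeneous_variable_neq Dhom' qj lq) (linear_at0 Dder.1) subr0 cE.
have -> : D' (c *: x q) = c *: D' (x q).
  by rewrite -[LHS]/(linear_fun Dder'.1 _) linearZ.
move: Dl Dq; rewrite cE cE' scalerA.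
have [->|c0] := eqVneq c 0; first by rewrite scale0r.
have [->|c0' _ _] := eqVneq c' 0; first by rewrite scale0r.
move=> /eqP; rewrite scaler_eq0 mulf_eq0 (negbTE c0) (negbTE c0') => /eqP.
exact: variable_neq0.
Qed.

(** The conjugates by [g] of the Euler derivations are again derivations of
    [A], and so are their multihomogeneous components, which can be read off the
    matrices of [g] and of its inverse. *)
Lemma conj_euler_root g l i q : graded_auts g ->
  coef_mx g l i != 0 -> coef_mx (g^-1)%g i q != 0 -> root_between l q.
Proof.
move=> gg gli giq; have gV := is_subgroupV (graded_auts_closed (I := I)).1 gg.
pose D u := (g^-1)%g (euler i (g u)).
have Dder : is_derivation D by apply/conj_derivation/euler_derivation.
have D0 : D 0 = 0 by exact: (linear_at0 Dder.1).
pose a := mnm_vec U_(q)%MM - mnm_vec U_(l)%MM : 'rV[int]_n.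
exists (component (@mnm_vec n) a D); split.
- by apply: component_derivation => //; apply: mnm_vecD.
- exact: component_homogeneous.
have -> : component (@mnm_vec n) a D (x l) =
    (coef_mx g l i * coef_mx (g^-1)%g i q) *: x q.
  have DE : D (x l) = coef_mx g l i *: \sum_j coef_mx (g^-1)%g i j *: x j.
    rewrite /D coef_mxE // [euler i _]linear_sum linear_sum (bigD1 i) //= big1 ?addr0 => [|j ji].
      by rewrite !linearZ /= euler_mon mnm1E eqxx scale1r -coef_mxE.
    by rewrite !linearZ /= euler_mon mnm1E (negbTE ji) scale0r linear0 scaler0.
  rewrite component_mon // DE /a addrC subrK linearZ linear_sum -scalerA.
  congr (_ *: _); rewrite (bigD1 q) //= big1 ?addr0 => [|j jq].
    by rewrite linearZ /= proj_mon eqxx.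
  rewrite linearZ /= proj_mon (inj_eq (@mnm_vec_inj n)) eq_mnm1 (negbTE jq).
  by rewrite scaler0.
move/eqP; rewrite scaler_eq0 mulf_eq0 (negbTE gli) (negbTE giq) => /eqP.
exact: variable_neq0.
Qed.

Lemma exp_square_zero (D : A -> A) g u : linear D -> is_exp D g -> D (D u) = 0 ->
  g u = u + D u.
Proof.
move=> Dlin /(exp_two_terms Dlin)[N ->] DDu.
rewrite big1 ?addr0 // => i _; rewrite !iterSr DDu.
have -> : iter i D 0 = 0 by elim: (i : nat) => //= m ->; rewrite linear_at0.
by rewrite scaler0.
Qed.

Lemma G1_subgroup : is_subgroup (G1 I).
Proof. exact: subgroup_generated_is_subgroup. Qed.

Lemma G1_generator g : (torus I `|` toric_automorphisms I `|`
    [set g | exists a p, [/\ is_root I a, coord_sum a = 0, N_space I a p, p <> 0 &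
       root_subgroup I a p g]]) g -> G1 I g.
Proof. by move=> gen H [_ sub]; apply: sub. Qed.

Lemma coord_sum_root_between l q :
  coord_sum (mnm_vec U_(q)%MM - mnm_vec U_(l)%MM : 'rV_n) = 0.
Proof.
apply: (addIr (coord_sum (mnm_vec U_(l)%MM : 'rV_n))).
by rewrite -coord_sumD subrK !coord_sum_mnm_vec !mdeg1 add0r.
Qed.

Lemma G1_transvection l q (t : k) : root_between l q -> l != q ->
  exists2 w, G1 I w &
    w (x l) = x l + t *: x q /\ forall j, j != l -> w (x j) = x j.
Proof.
move=> [D [Dder Dhom Dl]] lq; have [c cE] := homogeneous_variable Dhom.
have c0 : c != 0 by apply: contra_notN Dl => /eqP c0; rewrite cE c0 scale0r.
have [->|t0] := eqVneq t 0.
  by exists 1%g; [exact: G1_subgroup.1|rewrite scale0r addr0].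
(* Scaled to send [x l] to [t *: x q]; two applications kill every variable, so
   the exponential is [1 + D'] on variables. *)
pose D' u := (t / c) *: D u.
have Dder' : is_derivation D'.
  split=> [d u v|u v]; first by rewrite /D' Dder.1 scalerDr !scalerA mulrC.
  by rewrite /D' Dder.2 scalerDr scalerAl scalerAr.
have Dhom' : homogeneous_of_degree I (mnm_vec U_(q)%MM - mnm_vec U_(l)%MM) D'.
  by move=> b; have [d dE] := Dhom b; exists (t / c * d); rewrite /D' dE scalerA.
have Dl' : D' (x l) = t *: x q by rewrite /D' cE scalerA divfK.
have a0 : mnm_vec U_(q)%MM - mnm_vec U_(l)%MM <> 0 :> 'rV[int]_n.
  by move/subr0_eq/(@mnm_vec_inj n)/eqP; rewrite eq_mnm1 eq_sym (negbTE lq).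
have Dneq0 : exists u, D' u <> 0.
  exists (x l); rewrite Dl' => /eqP; rewrite scaler_eq0 (negbTE t0) => /eqP.
  exact: variable_neq0.
have [p [w [aroot Np p0 wU wexp]]] := root_exponential char0 a0 Dder' Dhom' Dneq0.
have Dj j : j != l -> D' (x j) = 0 by exact: homogeneous_variable_neq.
exists w.
  apply: G1_generator; right; exists (mnm_vec U_(q)%MM - mnm_vec U_(l)%MM), p.
  by split=> //; apply: coord_sum_root_between.
split=> [|j jl].
  rewrite (exp_square_zero Dder'.1 wexp) Dl' //.
  have -> : D' (t *: x q) = t *: D' (x q).
    by rewrite -[LHS]/(linear_fun Dder'.1 _) linearZ.
  by rewrite Dj ?scaler0 // eq_sym.
by rewrite (exp_square_zero Dder'.1 wexp) Dj ?addr0 // (linear_at0 Dder'.1).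
Qed.

Lemma G1_torus (t : 'I_n -> k) : (forall i, t i != 0) ->
  exists2 w, G1 I w & forall i, w (x i) = t i *: x i.
Proof.
move=> t0; have [w wE] := @torus_element _ _ I I_art t t0.
have wx i : w (x i) = t i *: x i.
  rewrite wE (bigD1 i) //= mnm1E eqxx expr1 big1 ?mulr1 // => j ji.
  by rewrite mnm1E eq_sym (negbTE ji) expr0.
exists w => //; apply: G1_generator; left; left; exists t; split=> // i.
exact/eqP.
Qed.

(** Diagonal matrices come from the torus and transvections from the root
    subgroups, so elimination produces an element of [G1] with matrix [Q]. *)
Lemma G1_incidence (Q : 'M[k]_n) : Q \in unitmx ->
  (forall l q, Q l q != 0 -> root_between l q) ->
  exists2 w, G1 I w & forall l, w (x l) = \sum_q Q l q *: x q.
Proof.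
move=> Qu Qroot; pose R : rel 'I_n := fun l q => `[< root_between l q >].
pose S (Q : 'M[k]_n) := exists2 w, G1 I w & forall l, w (x l) = \sum_q Q l q *: x q.
apply: (@incidence_unit_generated k n R _ _ S) => //.
- by move=> l; apply/asboolP/root_between_refl.
- by move=> q l j /asboolP lq /asboolP qj; apply/asboolP/(root_between_trans lq qj).
- move=> Q1 Q2 [w1 w1G w1E] [w2 w2G w2E].
  exists (w2 * w1)%g; first exact: is_subgroupM G1_subgroup w2G w1G.
  move=> l; rewrite aut_mulE w1E linear_sum.
  under eq_bigr => q _ do rewrite linearZ /= w2E scaler_sumr.
  rewrite exchange_big; apply: eq_bigr => q _ /=.
  by rewrite mxE scaler_suml; apply: eq_bigr => j _; rewrite scalerA.
- move=> d d0; have [w wG wE] := G1_torus d0; exists w => // l.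
  rewrite wE (bigD1 l) //= big1 ?addr0 => [|q ql]; first by rewrite mxE eqxx mulr1n.
  by rewrite mxE eq_sym (negbTE ql) mulr0n scale0r.
- move=> l q c /asboolP lq l_neq_q.
  have [w wG [wl wj]] := G1_transvection c lq l_neq_q; exists w => // j.
  have -> : \sum_q0 (1%:M + c *: delta_mx l q : 'M_n) j q0 *: x q0 =
      x j + (c * (j == l)%:R) *: x q.
    under eq_bigr => q0 _ do rewrite !mxE scalerDl.
    rewrite big_split; congr (_ + _) => /=.
      rewrite (bigD1 j) //= eqxx scale1r big1 ?addr0 // => q0 q0j.
      by rewrite eq_sym (negbTE q0j) scale0r.
    rewrite (bigD1 q) //= eqxx andbT big1 ?addr0 // => q0 q0q.
    by rewrite (negbTE q0q) andbF mulr0 scale0r.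
  have [->|jl] := eqVneq j l; first by rewrite wl mulr1.
  by rewrite wj // mulr0 scale0r addr0.
by move=> l q /Qroot lq; apply/asboolP.
Qed.

(** As [g] is injective, the class of [f] vanishes exactly when the class of the
    permuted polynomial does. *)
Lemma permuting_automorphism_toric g (s : 'S_n) : (forall i, g (x i) = x (s i)) ->
  toric_automorphisms I g.
Proof.
move=> gs; exists s; split=> // f; set lq := [tuple _ | i < n].
have gres f' : g (residue I f') = residue I (f' \mPo lq).
  rewrite residueE comp_mpolyEX !linear_sum; apply: eq_bigr => b _.
  rewrite !linearZ /=; congr (_ *: _).
  rewrite comp_mpolyX /mon mpolyXE_id !rmorph_prod.
  apply: eq_bigr => i _; rewrite !rmorphXn /=; congr (_ ^+ _).
  by rewrite tnth_mktuple; apply: gs.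
have gI f' : (residue I f' == 0) = (f' \in I).
  by apply/eqP/idP => /residue_eq0.
by rewrite -!gI -gres -[RHS](inj_eq (bij_inj (aut_bij g))) linear0.
Qed.

(** With [s] chosen in the support of the matrix of [g], the permuted rows of the
    inverse matrix lie in the incidence algebra of [root_between]; an element [w]
    of [G1] with that matrix makes [g * w] permute the variables. *)
Lemma graded_auts_sub_G1 : graded_auts (I := I) `<=` G1 I.
Proof.
move=> g gg; have gV := is_subgroupV (graded_auts_closed (I := I)).1 gg.
have NM := coef_mxVM gg; have [Nu Mu] := mulmx1_unit NM.
have [s Ms] := unitmx_det_term Mu.
pose Q := row_perm s (coef_mx (g^-1)%g).
have Qu : Q \in unitmx by rewrite /Q row_permE unitmx_mul unitmx_perm.
have Qroot l q : Q l q != 0 -> root_between l q.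
  by rewrite mxE; apply: conj_euler_root.
have [w wG wE] := G1_incidence Qu Qroot.
have gw i : (g * w)%g (x i) = x (s i).
  apply: (can_inj (aut_mulK (g^-1)%g)); rewrite aut_mulE aut_mulK wE coef_mxE //.
  by apply: eq_bigr => q _; rewrite mxE.
rewrite -[g]mulg1 -(mulgV w) mulgA.
apply: (is_subgroupM G1_subgroup); last exact: is_subgroupV G1_subgroup wG.
by apply: G1_generator; left; right; apply: permuting_automorphism_toric gw.
Qed.

Lemma G1_sub_graded_auts : G1 I `<=` graded_auts (I := I).
Proof.
move=> g; apply; split; first exact: (graded_auts_closed (I := I)).1.
move=> h [[[t [_ tE]]|[s [_ sE]]]|[a [p [aroot a0 Np _]]]].
- apply: graded_variables => i; exists (fun j => (j == i)%:R * t i).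
  rewrite (bigD1 i) //= eqxx mul1r big1 ?addr0 => [|j /negbTE ->]; last first.
    by rewrite mul0r scale0r.
  exact: tE.
- apply: graded_variables => i; exists (fun j => (j == s i)%:R).
  rewrite (bigD1 (s i)) //= eqxx scale1r big1 ?addr0 => [|j /negbTE ->]; last first.
    by rewrite scale0r.
  exact: sE.
exact: neutral_root_subgroup_graded.
Qed.

Lemma G1E : G1 I = graded_auts (I := I).
Proof.
by apply/seteqP; split; [exact: G1_sub_graded_auts|exact: graded_auts_sub_G1].
Qed.

End GradedAutomorphisms.

(** * The semidirect decomposition *)

Section SemidirectDecomposition.
Variables (k : fieldType) (n : nat) (I : idealr {mpoly k[n]}).
Context {I_art : artinian_monomial I}.

Lemma raises1_graded_semidirect :
  is_semidirect_product (raises (I := I) 1) (graded_auts (I := I)).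
Proof.
split.
- exact: raises1_closed.
- exact: graded_auts_closed.
- split=> [|g h /raises1_linear_part h1]; first exact: raises_subgroup.
  by apply/raises1_linear_part; rewrite !linear_partM h1 mulg1 linear_partV mulgV.
- apply/seteqP; split=> g; first by case=> /raises1_linear_part + gg; rewrite [X in X = _]gg.
  move=> ->; split; first exact: (raises_subgroup 1).1.
  exact: (graded_auts_closed (I := I)).1.1.
exists (@unipotent_part k n I I_art), (@linear_part k n I I_art); split.
- exact: regular_unipotent_part.
- exact: regular_linear_part.
move=> g; split; last by rewrite /unipotent_part -mulgA mulVg mulg1.
  apply/raises1_linear_part.
  by rewrite /unipotent_part linear_partM linear_partV linear_part_id mulgV.
exact: linear_part_id.
Qed.

End SemidirectDecomposition.

Theorem proposition2p5 (k : closedFieldType) (char0 : [pchar k] =i pred0)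
  (n : nat) (n_gt0 : (0 < n)%N) (I : idealr {mpoly k[n]})
  (I_monomial : monomial_ideal I) (I_cofinite : cofinite_support I)
  (X_notin_I : forall i : 'I_n, 'X_i \notin I)
  (m : idealr (monomial_algebra I)) (m_max : the_maximal_ideal m) :
  let U1 := cotangent_kernel m_max in
  is_semidirect_product U1 (G1 I) /\
  [/\ closed_subgroup U1, zariski_connected U1, unipotent_subset U1 &
      U1 = subgroup_generated (positive_root_subgroups I)].
Proof.
have I_art : artinian_monomial I by split.
rewrite /= cotangent_kernelE G1E //; split; first exact: raises1_graded_semidirect.
split.
- exact: raises1_closed.
- exact: raises1_connected.
- exact: raises1_unipotent.
exact: raises1_generated.
Qed.
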